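(* Let $C\subset\mathbb{R}^3$ be a pointed polyhedral cone. Then $S_C=C\cap\mathbb{Z}^3$ is $(R,G)$-finitely generated if and only if either all extreme rays of $C$ are rational, or $C$ is simple with extreme rays $[u_1],[u_2],[u_3]$ such that $u_1,u_2,u_3$ are eigenvectors, with pairwise distinct positive eigenvalues, of some non-identity matrix $A\in\mathrm{GL}(3,\mathbb{Z})$.
   Context: A simple polyhedral cone in $\mathbb{R}^3$ is one generated by $3$ linearly independent vectors. For $u\in\mathbb{R}^n$, $[u]=\{cu:c>0\}$; an extreme ray $[u]$ is rational if $[u]=[u']$ for some $u'\in\mathbb{Q}^n$. $\mathrm{GL}(n,\mathbb{Z})$ is the group of integer $n\times n$ matrices with determinant $\pm1$. For a convex cone $C\subseteq\mathbb{R}^n$ let $S_C:=C\cap\mathbb{Z}^n$. $S_C$ is called $(R,G)$-finitely generated if there exist a finite subset $R\subseteq S_C$ and a finitely generated subgroup $G\subseteq\mathrm{GL}(n,\mathbb{Z})$ acting linearly on $C$ (written $x\mapsto T\cdot x$) such that (1) $G\cdot C=C$ and $G\cdot S_C=S_C$, and (2) every $s\in S_C$ can be written as a finite sum $s=\sum_{i}\lambda_i\,T_i\cdot r_i$ with $r_i\in R$, $T_i\in G$, $\lambda_i\in\mathbb{Z}_{\ge0}$.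
   Formalization: The ''only if'' direction is proved for C spanning R^3; without this it fails, e.g. for the ray of (1, √2, 0), where S_C = {0} is (R,G)-finitely generated but the ray is irrational and C is not simple. The ''if'' direction holds for every pointed polyhedral cone. *)

(* Defs.v *)
From HB Require Import structures.
From mathcomp Require Import all_boot all_order all_algebra.
From mathcomp Require Import all_classical all_reals.

Set Implicit Arguments.
Unset Strict Implicit.
Unset Printing Implicit Defensive.

Import Order.TTheory GRing.Theory Num.Theory.

Local Open Scope classical_set_scope.
Local Open Scope ring_scope.

(* The cone generated by the columns of V. *)
Definition cone_of (R : realType) (n k : nat) (V : 'M[R]_(n, k)) :
    set 'cV[R]_n :=
  [set x | exists2 c : 'cV[R]_k, (forall i, 0 <= c i 0) & x = V *m c].

Definition polyhedral_cone (R : realType) (n : nat) (C : set 'cV[R]_n) :=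
  exists k (V : 'M[R]_(n, k)), C = cone_of V.

Definition simple_cone (R : realType) (n : nat) (C : set 'cV[R]_n) :=
  exists2 V : 'M[R]_n, V \in unitmx & C = cone_of V.

Definition pointed (R : realType) (n : nat) (C : set 'cV[R]_n) :=
  forall x, C x -> C (- x) -> x = 0.

(* C contains n linearly independent vectors, i.e. it spans R^n.  A cone with
   an irrational extreme ray that does not span can have C `&` Z^n = {0}, which
   is trivially finitely generated: take the ray of (1, sqrt 2, 0). *)
Definition full_dimensional (R : realType) (n : nat) (C : set 'cV[R]_n) :=
  exists2 V : 'M[R]_n, V \in unitmx & forall j, C (col j V).

(* [u] = {c u : c > 0} *)
Definition ray (R : realType) (n : nat) (u : 'cV[R]_n) : set 'cV[R]_n :=
  [set x | exists2 c : R, 0 < c & x = c *: u].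

Definition extreme_rays (R : realType) (n : nat) (C : set 'cV[R]_n) :
    set (set 'cV[R]_n) :=
  [set r | exists u : 'cV[R]_n,
    [/\ u != 0, C u, r = ray u &
        forall x y, C x -> C y -> r (x + y) ->
          (x = 0 \/ r x) /\ (y = 0 \/ r y)]].

Definition rational_ray (R : realType) (n : nat) (r : set 'cV[R]_n) :=
  exists u' : 'cV[rat]_n, r = ray (map_mx ratr u').

(* The units of int are 1 and -1, so unitmx is the condition det = 1 or -1. *)
Definition GLZ (n : nat) : set 'M[int]_n := [set A | A \in unitmx].

Definition GLZ_subgroup (n : nat) (G : set 'M[int]_n) :=
  [/\ G `<=` @GLZ n, G 1%:M,
      (forall A B, G A -> G B -> G (A *m B)) &
      (forall A, G A -> G (invmx A))].

Definition fin_gen_subgroup (n : nat) (G : set 'M[int]_n) :=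
  GLZ_subgroup G /\
  exists F : set 'M[int]_n,
    [/\ finite_set F, F `<=` G & G = smallest (@GLZ_subgroup n) F].

Definition act (R : realType) (n : nat) (T : 'M[int]_n) (x : 'cV[R]_n) :
    'cV[R]_n :=
  map_mx intr T *m x.

Definition act_set (R : realType) (n : nat) (G : set 'M[int]_n)
    (X : set 'cV[R]_n) : set 'cV[R]_n :=
  [set act T x | T in G & x in X].

Definition int_points (R : realType) (n : nat) (C : set 'cV[R]_n) :
    set 'cV[R]_n :=
  C `&` [set map_mx intr z | z in [set: 'cV[int]_n]].

Definition RG_generates (R : realType) (n : nat) (S Rgen : set 'cV[R]_n)
    (G : set 'M[int]_n) :=
  forall s, S s ->
    exists k (lam : 'I_k -> nat) (T : 'I_k -> 'M[int]_n)
        (r : 'I_k -> 'cV[R]_n),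
      [/\ forall i, Rgen (r i), forall i, G (T i) &
          s = \sum_(i < k) act (T i) (r i) *+ lam i].

(* S_C = int_points C is (R,G)-finitely generated. *)
Definition RG_finitely_generated (R : realType) (n : nat)
    (C : set 'cV[R]_n) :=
  exists (Rgen : set 'cV[R]_n) (G : set 'M[int]_n),
    [/\ finite_set Rgen /\ Rgen `<=` int_points C,
        fin_gen_subgroup G,
        act_set G C = C,
        act_set G (int_points C) = int_points C &
        RG_generates (int_points C) Rgen G].

Definition eigenvector (R : realType) (n : nat) (A : 'M[int]_n)
    (a : R) (u : 'cV[R]_n) :=
  u != 0 /\ act A u = a *: u.

Definition all_rays_rational (R : realType) (n : nat) (C : set 'cV[R]_n) :=
  forall r, extreme_rays C r -> rational_ray r.

Definition simple_with_eigenrays (R : realType) (C : set 'cV[R]_3) :=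
  simple_cone C /\
  exists u : 'I_3 -> 'cV[R]_3,
    extreme_rays C = [set ray (u i) | i in [set: 'I_3]] /\
    exists (A : 'M[int]_3) (a : 'I_3 -> R),
      [/\ GLZ A, A <> 1%:M, injective a &
          forall i, 0 < a i /\ eigenvector A (a i) (u i)].

(* Main.v *)
(* Necessity.  The group permutes the extreme rays of C.  An element fixing all
   of them is diagonalizable with positive eigenvalues; if two of these
   coincide, the double one is rational, hence all are 1.  If three of them are
   distinct, the only extreme rays are the three eigenrays.  Otherwise the
   group acts faithfully on the extreme rays and is finite, so S_C is a
   finitely generated monoid, and Farkas' lemma shows that every extreme ray
   contains one of its generators.

   Sufficiency.  Rational cones are covered by Gordan's lemma.  For eigenrays,
   measure points by the sum of their coordinates in the eigenbasis.  If no
   eigenvalue is 1, the characteristic polynomial is irreducible, and Dirichlet's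
   pigeonhole argument gives for each eigenvector a unit of Z[A] that contracts
   the other two.  A point which is lowest under these three units has
   comparable coordinates, so a fixed interior integer point can be subtracted
   from it unless it is one of finitely many.  If 1 is an eigenvalue, A and A^-1
   play the role of these units in the plane of the other two eigenvectors. *)
Require Import Defs.
From HB Require Import structures.
From mathcomp Require Import all_boot all_order all_algebra.
From mathcomp Require Import all_classical all_reals.
From mathcomp Require Import ring lra.

Set Implicit Arguments.
Unset Strict Implicit.
Unset Printing Implicit Defensive.

Import Order.TTheory GRing.Theory Num.Theory.

Local Open Scope classical_set_scope.
Local Open Scope ring_scope.

(** * Cones and extreme rays *)

Definition conic (R : realType) n k (v : 'I_k -> 'cV[R]_n) : set 'cV[R]_n :=
  [set x | exists2 c : 'I_k -> R,
             (forall i, 0 <= c i) & x = \sum_i c i *: v i].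

Lemma mulmx_col_scale (R : realType) n k (V : 'M[R]_(n, k)) (c : 'cV[R]_k) :
  V *m c = \sum_i c i 0 *: col i V.
Proof.
apply/matrixP=> i j; rewrite !mxE summxE; apply: eq_bigr => l _.
by rewrite !mxE ord1 mulrC.
Qed.

Lemma cone_ofE (R : realType) n k (V : 'M[R]_(n, k)) :
  cone_of V = conic (fun i => col i V).
Proof.
apply/seteqP; split=> x [c c0 ->].
  by exists (fun i => c i 0) => //; rewrite mulmx_col_scale.
exists (\col_i c i) => [i|]; first by rewrite mxE.
by rewrite mulmx_col_scale; apply: eq_bigr => i _; rewrite mxE.
Qed.

Section ConicTheory.
Variables (R : realType) (n k : nat) (v : 'I_k -> 'cV[R]_n).

Lemma conicD x y : conic v x -> conic v y -> conic v (x + y).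
Proof.
move=> [c c0 ->] [d d0 ->]; exists (fun i => c i + d i) => [i|].
  by rewrite addr_ge0.
by rewrite -big_split; apply: eq_bigr => i _; rewrite scalerDl.
Qed.

Lemma conicZ a x : 0 <= a -> conic v x -> conic v (a *: x).
Proof.
move=> a0 [c c0 ->]; exists (fun i => a * c i) => [i|]; first exact: mulr_ge0.
by rewrite scaler_sumr; apply: eq_bigr => i _; rewrite scalerA.
Qed.

Lemma conic0 : conic v 0.
Proof. by exists (fun=> 0) => //; rewrite big1 // => i _; rewrite scale0r. Qed.

Lemma conic_gen i : conic v (v i).
Proof.
exists (fun j => (j == i)%:R) => [j|]; first exact: ler0n.
rewrite (bigD1 i) //= eqxx scale1r big1 ?addr0 // => j /negPf->.
by rewrite scale0r.
Qed.

Lemma conic_sum (I : Type) (r : seq I) (P : pred I) (F : I -> 'cV[R]_n) :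
  (forall i, P i -> conic v (F i)) -> conic v (\sum_(i <- r | P i) F i).
Proof. by move=> H; apply: big_ind => //; [exact: conic0|exact: conicD]. Qed.

Lemma conic_sub l (w : 'I_l -> 'cV[R]_n) :
  (forall i, conic v (w i)) -> conic w `<=` conic v.
Proof.
by move=> H x [c c0 ->]; apply: conic_sum => i _; apply: conicZ.
Qed.

End ConicTheory.

(** Induction on the number of generators. A functional [l] separates [u] from all generators but
    [a]; if it is negative at [a], project along [a] onto the kernel of [l], separate there and
    compose with the projection. *)
Lemma farkas (R : realType) n k (v : 'I_k -> 'cV[R]_n) (u : 'cV[R]_n) :
  ~ conic v u ->
  exists2 l : 'rV[R]_n, forall i, 0 <= (l *m v i) 0 0 & (l *m u) 0 0 < 0.
Proof.
elim: k v u => [|k IH] v u vu.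
  exists (- u^T) => [[]//|].
  rewrite mulNmx mxE oppr_lt0 mxE lt0r sumr_ge0 ?andbT; last first.
    by move=> i _; rewrite mxE -expr2 sqr_ge0.
  apply/negP; rewrite psumr_eq0; last by move=> i _; rewrite mxE -expr2 sqr_ge0.
  move/allP => H; apply: vu; exists (fun=> 0) => //; rewrite big_ord0.
  apply/matrixP=> i j; rewrite ord1 mxE; apply/eqP.
  by have := H i (mem_index_enum _); rewrite mxE -expr2 sqrf_eq0.
pose w i := v (lift ord0 i); pose a := v ord0.
have {}vu c b : 0 <= c -> conic w b -> u <> c *: a + b.
  move=> c0 [d d0 ->] E; apply: vu.
  exists (fun i => oapp d c (unlift ord0 i)) => [i|].
    by case: unliftP => [j|] _ /=.
  rewrite big_ord_recl unlift_none /= E; congr (_ + _).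
  by apply: eq_bigr => i _; rewrite liftK.
have [|l lw lu] := IH w u.
  by move=> wu; apply: (vu 0 u) => //; rewrite scale0r add0r.
have [la|la] := leP 0 ((l *m a) 0 0).
  exists l => // i; case: (unliftP ord0 i) => [j|] -> //; exact: lw.
set p := (l *m a) 0 0 in la.
pose h x := x - ((l *m x) 0 0 / p) *: a.
have [|l' lw' lu'] := IH (h \o w) (h u).
  (* Lifting a representation of [h u] back to [u] adds a multiple of [a]. Its coefficient is
     nonnegative, since [l] is negative at [u] and [a] and nonnegative on [w]. *)
  move=> [c c0 E].
  apply: (vu ((l *m u) 0 0 / p - \sum_i c i * ((l *m w i) 0 0 / p))
             (\sum_i c i *: w i)).
  - rewrite subr_ge0; apply: (@le_trans _ _ 0).
      apply: sumr_le0 => i _; apply: mulr_ge0_le0 => //.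
      by apply: mulr_ge0_le0 => //; rewrite invr_le0 ltW.
    by apply: mulr_le0; [exact: ltW|rewrite invr_le0 ltW].
  - by exists c.
  rewrite -[LHS](subrK (((l *m u) 0 0 / p) *: a)) -/(h u) E.
  rewrite scalerBl scaler_suml -addrA addrC; congr (_ + _).
  rewrite addrC -sumrB; apply: eq_bigr => i _.
  by rewrite /= /h scalerBr scalerA.
have E x : ((l' - ((l' *m a) 0 0 / p) *: l) *m x) 0 0 = (l' *m h x) 0 0.
  rewrite /h mulmxBl mulmxBr -scalemxAl -scalemxAr !mxE; ring.
exists (l' - ((l' *m a) 0 0 / p) *: l) => [i|]; rewrite E //.
case: (unliftP ord0 i) => [j|] ->; first exact: lw'.
by rewrite /h -/a -/p divff ?lt_eqF // scale1r subrr mulmx0 mxE.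
Qed.

Lemma ray_refl (R : realType) n (u : 'cV[R]_n) : ray u u.
Proof. by exists 1; rewrite ?ltr01 ?scale1r. Qed.

Lemma ray_eq (R : realType) n (u x : 'cV[R]_n) : ray u x -> ray u = ray x.
Proof.
move=> [c c0 ->]; apply/seteqP; split=> y [d d0 ->].
  exists (d / c); first exact: divr_gt0.
  by rewrite scalerA divfK ?gt_eqF.
by exists (d * c); rewrite ?mulr_gt0 // scalerA.
Qed.

Lemma ray_unscale (R : realType) n (u w : 'cV[R]_n) c :
  u != 0 -> 0 <= c -> ray u (c *: w) -> ray u w.
Proof.
move=> u0 c0 [d d0 E]; have c1 : c != 0.
  apply: contraTneq d0 => c1; move: E; rewrite c1 scale0r => /esym/eqP.
  by rewrite scaler_eq0 (negPf u0) orbF => /eqP->; rewrite ltxx.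
exists (d / c); first by rewrite divr_gt0 // lt_neqAle eq_sym c1.
by apply: (scalerI c1); rewrite E scalerA mulrC divfK.
Qed.

(** Splitting off one summand at a time, extremality makes it 0 or puts it on the ray. If none were
    on the ray, the sum would be 0, which the ray does not contain. *)
Lemma extreme_ray_summand (R : realType) n k (v : 'I_k -> 'cV[R]_n) r
    (I : finType) (F : I -> 'cV[R]_n) :
  extreme_rays (conic v) r -> r (\sum_i F i) ->
  (forall i, conic v (F i)) -> exists i, r (F i).
Proof.
move=> [u [u0 _ -> uext]] uF CF; apply: contrapT => /forallNP nF.
have F0 i : F i = 0.
  have CR : conic v (\sum_(j | j != i) F j) by apply: conic_sum.
  have := uF; rewrite (bigD1 i) //= => /(uext _ _ (CF i) CR)[[]//].
  by move/(nF i).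
move: uF; rewrite big1 // => -[c c0 /esym/eqP].
by rewrite scaler_eq0 (negPf u0) gt_eqF.
Qed.

Lemma extreme_ray_gen (R : realType) n k (v : 'I_k -> 'cV[R]_n) r :
  extreme_rays (conic v) r -> exists i, r = ray (v i).
Proof.
move=> rv; have [u [u0 [c c0 Eu] Er _]] := rv.
have [||i] := extreme_ray_summand (F := fun i => c i *: v i) rv.
- by rewrite -Eu Er; apply: ray_refl.
- by move=> i; apply: conicZ => //; apply: conic_gen.
by rewrite Er => /(ray_unscale u0 (c0 i))/ray_eq->; exists i.
Qed.

(** In a generating family of least size no generator lies in the cone of the others; this is
    [irr]. *)
Lemma minimal_generators (R : realType) n (C : set 'cV[R]_n) :
  polyhedral_cone C -> pointed C ->
  exists k (v : 'I_k -> 'cV[R]_n),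
    [/\ C = conic v, forall i, v i != 0,
        forall i, extreme_rays C (ray (v i)) &
        injective (fun i => ray (v i))].
Proof.
move=> [k0 [V0 C0]] ptC.
pose P k := `[< exists v : 'I_k -> 'cV[R]_n, C = conic v >].
have exP : exists k, P k.
  by exists k0; apply/asboolP; exists (fun i => col i V0); rewrite -cone_ofE.
case: (ex_minnP exP) => k /asboolP[v Cv] kmin.
have irr i : ~ conic (fun j : 'I_k.-1 => v (lift i j)) (v i).
  move=> vi; have: (k <= k.-1)%N.
    apply: kmin; apply/asboolP; exists (fun j => v (lift i j)); rewrite Cv.
    apply/seteqP; split; apply: conic_sub => j; last exact: conic_gen.
    case: (unliftP i j) => [l|] -> //.
    exact: (conic_gen (fun j => v (lift i j))).
  by rewrite leqNgt ltn_predL (leq_ltn_trans _ (ltn_ord i)).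
have v0 i : v i != 0.
  by apply/eqP => vi; apply: (irr i); rewrite vi; apply: conic0.
exists k, v; split=> // [i|i j].
  exists (v i); split=> //; first by rewrite Cv; apply: conic_gen.
  move=> x y; rewrite Cv => -[a a0 ->] [b b0 ->] [c c0].
  pose e j := a j + b j.
  have e0 j : 0 <= e j by rewrite addr_ge0.
  rewrite -big_split /= (eq_bigr (fun j => e j *: v j)); last first.
    by move=> j _; rewrite -scalerDl.
  rewrite (bigD1_ord i) //= => Es.
  (* If [e i < c], solving for [v i] puts it in the cone of the others. Otherwise the negative of
     every other term [e j *: v j] lies in [C], and pointedness kills the term. *)
  have [ci|ci] := ltP (e i) c.
    case: (irr i).
    have -> : v i = (c - e i)^-1 *:
        \sum_(j < k.-1) e (lift i j) *: v (lift i j).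
      apply: (scalerI (a := c - e i)); first by rewrite subr_eq0 gt_eqF.
      rewrite scalerA divff ?subr_eq0 ?gt_eqF // scale1r scalerBl -Es.
      by rewrite addrAC subrr add0r.
    apply: conicZ; first by rewrite invr_ge0 subr_ge0 ltW.
    by exists (fun j => e (lift i j)).
  have ej j : j != i -> e j = 0.
    case: (unliftP i j) => [l|] ->; rewrite ?eqxx // => _.
    have /eqP : e (lift i l) *: v (lift i l) = 0.
      apply: ptC; first by rewrite Cv; apply: conicZ => //; apply: conic_gen.
      have -> : - (e (lift i l) *: v (lift i l)) = (e i - c) *: v i +
          \sum_(j | j != l) e (lift i j) *: v (lift i j).
        apply/eqP; rewrite eq_sym -addr_eq0 scalerBl -Es.
        rewrite (bigD1 l) //= opprD addrA subrr sub0r -addrA.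
        by rewrite [X in _ + X]addrC addNr.
      rewrite Cv; apply: conicD.
        by apply: conicZ; [rewrite subr_ge0|apply: conic_gen].
      by apply: conic_sum => j' _; apply: conicZ => //; apply: conic_gen.
    by rewrite scaler_eq0 (negPf (v0 _)) orbF => /eqP.
  have key (d : 'I_k -> R) : (forall j, 0 <= d j) -> (forall j, d j <= e j) ->
      \sum_j d j *: v j = 0 \/ ray (v i) (\sum_j d j *: v j).
    move=> d0 de; have -> : \sum_j d j *: v j = d i *: v i.
      rewrite (bigD1 i) //= big1 ?addr0 // => j ji.
      have /eqP : d j == 0 by rewrite eq_le d0 -(ej j ji) de.
      by move->; rewrite scale0r.
    have [->|di] := eqVneq (d i) 0; first by left; rewrite scale0r.
    by right; exists (d i) => //; rewrite lt_neqAle eq_sym di d0.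
  by split; apply: key => // j; rewrite ?lerDl ?lerDr.
move=> E; apply/eqP/negPn/negP => ij.
have [c c0 E'] : ray (v j) (v i) by rewrite -E; apply: ray_refl.
apply: (irr i); rewrite E'; apply: conicZ; first exact: ltW.
case: (unliftP i j) ij => [l|] ->; rewrite ?eqxx // => _.
exact: (conic_gen (fun j => v (lift i j))).
Qed.

(** * Groups acting on integer points *)

Section Act.
Variables (R : realType) (n : nat).
Implicit Types (x y : 'cV[R]_n) (A B : 'M[int]_n).

Lemma act1 x : act 1%:M x = x.
Proof. by rewrite /act map_mx1 mul1mx. Qed.

Lemma actM A B x : act (A *m B) x = act A (act B x).
Proof. by rewrite /act map_mxM mulmxA. Qed.

Lemma actD A x y : act A (x + y) = act A x + act A y.
Proof. by rewrite /act mulmxDr. Qed.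

Lemma actZ A a x : act A (a *: x) = a *: act A x.
Proof. by rewrite /act -scalemxAr. Qed.

Lemma act_sum A (I : Type) (r : seq I) (P : pred I) (F : I -> 'cV[R]_n) :
  act A (\sum_(i <- r | P i) F i) = \sum_(i <- r | P i) act A (F i).
Proof. by rewrite /act mulmx_sumr. Qed.

Lemma act_int A (z : 'cV[int]_n) :
  act A (map_mx intr z) = map_mx intr (A *m z) :> 'cV[R]_n.
Proof. by rewrite /act map_mxM. Qed.

Lemma actK A x : GLZ A -> act (invmx A) (act A x) = x.
Proof. by move=> GA; rewrite -actM mulVmx // act1. Qed.

Lemma actVK A x : GLZ A -> act A (act (invmx A) x) = x.
Proof. by move=> GA; rewrite -actM mulmxV // act1. Qed.

End Act.

(** By the hypothesis GL(n,Z) is itself one of the intersected subgroups; closure passes to the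
    intersection. *)
Lemma GLZ_subgroup_smallest n (F : set 'M[int]_n) :
  F `<=` @GLZ n -> GLZ_subgroup (smallest (@GLZ_subgroup n) F).
Proof.
move=> FG; split.
- apply: smallest_sub => //; split=> //; first exact: unitmx1.
    by move=> A B GA GB; rewrite /GLZ /= unitmx_mul GA.
  by move=> A; rewrite /GLZ /= unitmx_inv.
- by move=> H [[]].
- move=> A B GA GB H /= HF; have [[_ _ + _] _] := HF.
  by apply; [apply: GA|apply: GB].
- by move=> A GA H /= HF; have [[_ _ _ +] _] := HF; apply; apply: GA.
Qed.

(** The equivalence, instead of one implication, gives closure under inverses. *)
Definition stabilizer (R : realType) n (C : set 'cV[R]_n) : set 'M[int]_n :=
  [set A | GLZ A /\ forall x, C (act A x) <-> C x].

Lemma stabilizer_subgroup (R : realType) n (C : set 'cV[R]_n) :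
  GLZ_subgroup (stabilizer C).
Proof.
split.
- by move=> A [].
- by split=> [|x]; [exact: unitmx1|rewrite act1].
- move=> A B [GA CA] [GB CB]; split=> [|x].
    by rewrite /GLZ /= unitmx_mul GA.
  by rewrite actM CA.
- move=> A [GA CA]; split=> [|x]; first by rewrite /GLZ /= unitmx_inv.
  by rewrite -CA actVK.
Qed.

Definition RG_span (R : realType) n (Rgen : set 'cV[R]_n) (G : set 'M[int]_n)
    : set 'cV[R]_n :=
  [set s | exists k (lam : 'I_k -> nat) (T : 'I_k -> 'M[int]_n)
        (r : 'I_k -> 'cV[R]_n),
      [/\ forall i, Rgen (r i), forall i, G (T i) &
          s = \sum_(i < k) act (T i) (r i) *+ lam i]].

Section Span.
Variables (R : realType) (n : nat) (Rgen : set 'cV[R]_n) (G : set 'M[int]_n).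

Lemma RG_span0 : RG_span Rgen G 0.
Proof.
exists 0%N, (fun=> 0%N), (fun=> 0), (fun=> 0).
by split; rewrite ?big_ord0 // => -[].
Qed.

Lemma RG_spanD x y :
  RG_span Rgen G x -> RG_span Rgen G y -> RG_span Rgen G (x + y).
Proof.
move=> [k [a [S [r [rR SG ->]]]]] [l [b [T [s [sR TG ->]]]]].
pose glue U (f : 'I_k -> U) (g : 'I_l -> U) i :=
  match fintype.split i with inl j => f j | inr j => g j end.
exists (k + l)%N, (glue _ a b), (glue _ S T), (glue _ r s).
split=> [i|i|]; rewrite /glue; try by case: fintype.split.
rewrite big_split_ord /=; congr (_ + _); apply: eq_bigr => i _.
  by rewrite (unsplitK (inl i)).
by rewrite (unsplitK (inr i)).
Qed.

Lemma RG_span_gen T r m : G T -> Rgen r -> RG_span Rgen G (act T r *+ m).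
Proof.
move=> GT Rr; exists 1%N, (fun=> m), (fun=> T), (fun=> r).
by split=> //; rewrite big_ord1.
Qed.

Lemma RG_span_sum (I : Type) (t : seq I) (P : pred I) (F : I -> 'cV[R]_n) :
  (forall i, P i -> RG_span Rgen G (F i)) ->
  RG_span Rgen G (\sum_(i <- t | P i) F i).
Proof.
by move=> H; apply: big_ind => //; [exact: RG_span0|exact: RG_spanD].
Qed.

Lemma RG_span_act T x : GLZ_subgroup G -> G T ->
  RG_span Rgen G x -> RG_span Rgen G (act T x).
Proof.
move=> [_ _ GM _] GT [k [a [S [r [rR SG ->]]]]].
exists k, a, (fun i => T *m S i), r; split=> // [i|]; first exact: GM.
by rewrite act_sum; apply: eq_bigr => i _; rewrite actM /act linearMn.
Qed.

End Span.

(** The group generated by [F] stays inside the stabilizer, which gives the invariance of [C] and of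
    its integer points. *)
Lemma RG_finitely_generated_intro (R : realType) n (C Rgen : set 'cV[R]_n)
    (F : set 'M[int]_n) :
  finite_set F -> F `<=` stabilizer C ->
  finite_set Rgen -> Rgen `<=` int_points C ->
  int_points C `<=` RG_span Rgen (smallest (@GLZ_subgroup n) F) ->
  RG_finitely_generated C.
Proof.
move=> finF FC finR RC Cspan.
have GG : GLZ_subgroup (smallest (@GLZ_subgroup n) F).
  by apply: GLZ_subgroup_smallest => A /FC[].
have GC : smallest (@GLZ_subgroup n) F `<=` stabilizer C.
  by apply: smallest_sub => //; apply: stabilizer_subgroup.
have [_ G1 _ _] := GG.
exists Rgen, (smallest (@GLZ_subgroup n) F); split=> //.
- by split=> //; exists F; split=> //; apply: sub_gen_smallest.
- apply/seteqP; split=> [_ [T /GC[_ TC] [x Cx <-]]|x Cx].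
    exact/TC.
  by exists 1%:M => //; exists x => //; rewrite act1.
- apply/seteqP; split=> [_ [T /GC[_ TC] [x [Cx [z _ zx]] <-]]|x Cx].
    by split; [exact/TC|exists (T *m z) => //; rewrite -zx act_int].
  by exists 1%:M => //; exists x => //; rewrite act1.
Qed.

(** * Integer points: finiteness and rounding *)

Lemma finite_bounded_int_points (R : realType) n (K : R) :
  finite_set [set x : 'cV[R]_n |
    (exists z : 'cV[int]_n, x = map_mx intr z) /\ forall i, `|x i 0| <= K].
Proof.
(* Entries in [-N, N] are coded by the ordinals below 2N + 1, shifted by N. *)
pose N := (Num.truncn `|K|).+1.
pose f (w : 'cV['I_N.*2.+1]_n) : 'cV[R]_n :=
  map_mx (fun o : 'I_N.*2.+1 => (o : nat)%:R - N%:R) w.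
apply: (@sub_finite_set _ _ (range f)); last first.
  by apply: finite_image; apply: finite_finset.
move=> _ [[z ->] zK]; exists (\col_i inord (absz (z i 0 + N%:Z))) => //.
apply/matrixP=> i j; rewrite ord1 !mxE.
have zN : (`|z i 0| <= N%:Z)%R.
  rewrite -(ler_int R) intr_norm.
  have := zK i; rewrite mxE => /le_trans; apply.
  apply: (le_trans (ler_norm K)); rewrite -pmulrn.
  by rewrite ltW // truncnS_gt.
have zN0 : 0 <= z i 0 + N%:Z.
  by rewrite -lerBlDr sub0r; have := zN; rewrite ler_norml => /andP[].
rewrite inordK; last first.
  rewrite ltnS -lez_nat gez0_abs // -addnn PoszD lerD2r.
  by apply: le_trans zN; apply: ler_norm.
by rewrite -[X in X - _]/((Posz _)%:~R) gez0_abs // rmorphD /= addrK.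
Qed.

(** Rounding down changes each coordinate in the basis [W] by at most [L]. Adding [L] to every
    coordinate beforehand keeps the result above [x], by at most 2L. *)
Lemma int_rounding (R : realType) n (W : 'M[R]_n) : W \in unitmx ->
  exists2 K : R, 0 <= K & forall x : 'cV[R]_n, exists z : 'cV[int]_n,
    forall i, 0 <= (invmx W *m (map_mx intr z - x)) i 0 <= K.
Proof.
move=> Wu; pose L : R := \sum_i \sum_j `|invmx W i j|.
have L0 : 0 <= L by apply: sumr_ge0 => i _; apply: sumr_ge0.
exists (L + L) => [|x]; first exact: addr_ge0.
pose y := x + W *m const_mx L.
exists (map_mx Num.floor y) => i.
pose d := y - map_mx intr (map_mx Num.floor y).
have -> : map_mx intr (map_mx Num.floor y) - x = W *m const_mx L - d.
  by rewrite /d opprB addrCA -/y /y opprD [- x - _]addrC addNKr.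
have -> : (invmx W *m (W *m const_mx L - d)) i 0 = L - (invmx W *m d) i 0.
  by rewrite mulmxBr mulKmx // !mxE.
have : `|(invmx W *m d) i 0| <= L.
  rewrite mxE; apply: le_trans (ler_norm_sum _ _ _) _.
  rewrite /L [X in _ <= X](bigD1 i) //=; apply: ler_wpDr.
    by apply: sumr_ge0 => i' _; apply: sumr_ge0.
  apply: ler_sum => j _; rewrite normrM ler_piMr //.
  rewrite !mxE ger0_norm ?subr_ge0 ?floor_le //.
  by rewrite lerBlDl ltW // -intrD1 floorD1_gt.
by rewrite ler_norml => /andP[d1 d2]; rewrite subr_ge0 d2 lerD2l lerNl.
Qed.

Lemma conic_ray_sub (R : realType) n k l (v : 'I_k -> 'cV[R]_n)
    (w : 'I_l -> 'cV[R]_n) :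
  (forall i, exists j, ray (w j) (v i)) -> conic v `<=` conic w.
Proof.
move=> vw; apply: conic_sub => i; have [j [c c0 ->]] := vw i.
by apply: conicZ; [exact: ltW|exact: conic_gen].
Qed.

Lemma rational_ray_int (R : realType) n (r : set 'cV[R]_n) :
  rational_ray r -> exists w : 'cV[int]_n, r = ray (map_mx intr w).
Proof.
move=> [u ->]; exists (\col_i (numq (u i 0) * \prod_(j | j != i) denq (u j 0))).
apply: ray_eq; exists (\prod_j denq (u j 0))%:~R.
  by rewrite ltr0z; apply: prodr_gt0 => i _; apply: denq_gt0.
apply/matrixP=> i j; rewrite ord1 !mxE [in RHS](bigD1 i) //= !intrM mulrAC.
congr (_ * _); rewrite /ratr mulrC divfK // intr_eq0; exact: denq_neq0.
Qed.

(** * Gordan's lemma *)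

(** The group is trivial. Subtracting the integer parts of the coefficients leaves an integer point
    with coefficients in [0, 1), hence with entries at most [K]. *)
Lemma RG_finitely_generated_int_conic (R : realType) n k
    (w : 'I_k -> 'cV[int]_n) :
  RG_finitely_generated (conic (fun i => map_mx intr (w i) : 'cV[R]_n)).
Proof.
set v := fun i => _; set C := conic v.
pose K : R := \sum_i \sum_j `|v i j 0|.
have vK i j : `|v i j 0| <= \sum_j `|v i j 0|.
  by rewrite (bigD1 j) //= lerDl sumr_ge0.
pose Rgen := [set x : 'cV[R]_n |
  (exists z : 'cV[int]_n, x = map_mx intr z) /\ forall i, `|x i 0| <= K] `&` C.
have G1 : smallest (@GLZ_subgroup n) set0 1%:M by move=> H [[]].
apply: (@RG_finitely_generated_intro _ _ _ Rgen set0).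
- exact: finite_set0.
- by [].
- by apply: finite_setIl; apply: finite_bounded_int_points.
- by move=> x [[[z ->] _] Cx]; split=> //; exists z.
move=> s [[c c0 Es] [z _ zs]].
pose m i := Num.truncn (c i).
have mc i : (m i)%:R <= c i < (m i).+1%:R by apply: truncn_itv.
have -> : s = \sum_i v i *+ m i + \sum_i (c i - (m i)%:R) *: v i.
  rewrite Es -big_split; apply: eq_bigr => i _ /=.
  by rewrite scalerBl -scaler_nat addrC subrK.
apply: RG_spanD.
  apply: RG_span_sum => i _; rewrite -[v i]act1; apply: RG_span_gen => //.
  split; last exact: conic_gen.
  split=> [|j]; first by exists (w i).
  apply: le_trans (vK i j) _; rewrite /K [X in _ <= X](bigD1 i) //= lerDl.
  by apply: sumr_ge0 => i' _; apply: sumr_ge0.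
set t := (X in RG_span _ _ X).
rewrite -[t]mulr1n -[t]act1; apply: RG_span_gen => //; split; last first.
  exists (fun i => c i - (m i)%:R) => // i.
  by rewrite subr_ge0; case/andP: (mc i).
split.
  exists (z - \sum_i w i *+ m i).
  rewrite map_mxB zs Es raddf_sum -sumrB; apply: eq_bigr => i _.
  by rewrite scalerBl scaler_nat; congr (_ - _); rewrite [RHS]raddfMn.
move=> j; rewrite summxE; apply: le_trans (ler_norm_sum _ _ _) _.
apply: ler_sum => i _; rewrite mxE normrM.
apply: le_trans (vK i j); apply: ler_piMl => //.
case/andP: (mc i) => m1 m2; rewrite ger0_norm ?subr_ge0 //.
by rewrite lerBlDl natr1 ltW.
Qed.

Lemma rational_RG_finitely_generated (R : realType) n (C : set 'cV[R]_n) :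
  polyhedral_cone C -> pointed C -> all_rays_rational C ->
  RG_finitely_generated C.
Proof.
move=> Cpol Cpt Crat.
have [k [v [Cv v0 vext _]]] := minimal_generators Cpol Cpt.
have /choice[w vw] : forall i, exists w : 'cV[int]_n,
    ray (v i) = ray (map_mx intr w).
  by move=> i; apply: rational_ray_int; apply: Crat; apply: vext.
suff -> : C = conic (fun i => map_mx intr (w i)).
  exact: RG_finitely_generated_int_conic.
rewrite Cv; apply/seteqP; split; apply: conic_ray_sub => i; exists i.
  by rewrite -vw; apply: ray_refl.
by rewrite vw; apply: ray_refl.
Qed.

(** * Descent on the height in an eigenbasis *)

(** Applied not only to units but also to polynomials in a matrix, with the same polynomials in its
    eigenvalues. *)
Definition diagonalizes (R : realType) n (U : 'M[R]_n) (A : 'M[int]_n)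
    (a : 'I_n -> R) :=
  forall i, act A (col i U) = a i *: col i U.

Section Diagonal.
Variables (R : realType) (n : nat) (U : 'M[R]_n).
Hypothesis Uu : U \in unitmx.
Implicit Types (A B : 'M[int]_n) (a b : 'I_n -> R).

Lemma diagonalizesP A a : diagonalizes U A a <->
  map_mx intr A *m U = U *m diag_mx (\row_i a i).
Proof.
split=> [H|H i].
  apply/matrixP=> i j; have /matrixP/(_ i 0) := H j.
  by rewrite mul_mx_diag !mxE mulrC => <-; apply: eq_bigr => l _; rewrite !mxE.
rewrite /act colE mulmxA H -!colE.
by apply/matrixP=> j l; rewrite mul_mx_diag !mxE mulrC.
Qed.

Lemma coord_act A a x i : diagonalizes U A a ->
  (invmx U *m act A x) i 0 = a i * (invmx U *m x) i 0.
Proof.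
move/diagonalizesP=> H; rewrite /act -{1}[x](mulKVmx Uu) !mulmxA.
rewrite -(mulmxA _ _ U) H !mulmxA mulVmx // mul1mx -mulmxA mul_diag_mx.
by rewrite !mxE.
Qed.

Lemma diagonalizes1 : diagonalizes U 1%:M (fun=> 1).
Proof. by move=> i; rewrite act1 scale1r. Qed.

Lemma diagonalizesM A B a b : diagonalizes U A a -> diagonalizes U B b ->
  diagonalizes U (A *m B) (fun i => a i * b i).
Proof. by move=> HA HB i; rewrite actM HB actZ HA scalerA mulrC. Qed.

Lemma diagonalizesD A B a b : diagonalizes U A a -> diagonalizes U B b ->
  diagonalizes U (A + B) (fun i => a i + b i).
Proof.
by move=> HA HB i; rewrite /act map_mxD mulmxDl scalerDl -HA -HB.
Qed.

Lemma diagonalizesZ A a (p : int) : diagonalizes U A a ->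
  diagonalizes U (p *: A) (fun i => p%:~R * a i).
Proof.
by move=> HA i; rewrite /act map_mxZ -scalemxAl -scalerA -HA.
Qed.

Lemma diagonalizesV A a : GLZ A -> (forall i, a i != 0) ->
  diagonalizes U A a -> diagonalizes U (invmx A) (fun i => (a i)^-1).
Proof.
move=> GA a0 HA i; rewrite -{2}[col i U](actK _ GA) HA actZ scalerA.
by rewrite mulVf ?scale1r.
Qed.

Lemma diagonalizes_conj A a : diagonalizes U A a ->
  map_mx intr A = U *m diag_mx (\row_i a i) *m invmx U.
Proof. by move/diagonalizesP<-; rewrite mulmxK. Qed.

Lemma diagonalizes_det A a : diagonalizes U A a ->
  (\det A)%:~R = \prod_i a i.
Proof.
move/diagonalizes_conj/(congr1 determinant).
rewrite det_map_mx !det_mulmx mulrAC -det_mulmx mulmxV // det1 mul1r => ->.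
by rewrite det_diag; apply: eq_bigr => i _; rewrite mxE.
Qed.

Lemma diagonalizes_tr A a : diagonalizes U A a ->
  (\tr A)%:~R = \sum_i a i.
Proof.
move/diagonalizes_conj/(congr1 mxtrace).
rewrite -mulmxA mxtrace_mulC mulmxKV // mxtrace_diag => E.
rewrite (eq_bigr (fun i => (\row_i a i) 0 i)) ?[LHS]E; last first.
  by move=> i _; rewrite mxE.
rewrite -E /mxtrace rmorph_sum; apply: eq_bigr => i _; by rewrite mxE.
Qed.

Lemma cone_of_coord x :
  cone_of U x <-> forall i, 0 <= (invmx U *m x) i 0.
Proof.
split=> [[c c0 ->] i|H]; first by rewrite mulKmx.
by exists (invmx U *m x) => //; rewrite mulKVmx.
Qed.

Lemma diagonalizes_stabilizer A a : GLZ A -> (forall i, 0 < a i) ->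
  diagonalizes U A a -> stabilizer (cone_of U) A.
Proof.
move=> GA a0 HA; split=> // x; rewrite !cone_of_coord.
by split=> H i; have := H i; rewrite (coord_act _ _ HA) pmulr_rge0.
Qed.

End Diagonal.

Definition height (R : realType) n (U : 'M[R]_n) (x : 'cV[R]_n) : R :=
  \sum_i (invmx U *m x) i 0.

Section Height.
Variables (R : realType) (n : nat) (U : 'M[R]_n).
Hypothesis Uu : U \in unitmx.

Lemma heightB x y : height U (x - y) = height U x - height U y.
Proof.
by rewrite /height mulmxBr -sumrB; apply: eq_bigr => i _; rewrite !mxE.
Qed.

Lemma coord_le_height x i : cone_of U x ->
  (invmx U *m x) i 0 <= height U x.
Proof.
move/(cone_of_coord Uu) => x0; rewrite /height (bigD1 i) //= lerDl.
exact: sumr_ge0.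
Qed.

Lemma height_gt0 x : cone_of U x -> x != 0 -> 0 < height U x.
Proof.
move=> Cx xn0; have x0 := Cx; move/(cone_of_coord Uu) in x0.
have h0 : 0 <= height U x by apply: sumr_ge0.
rewrite lt_neqAle h0 andbT; apply: contra_neq xn0 => hx.
rewrite -[x](mulKVmx Uu) (_ : invmx U *m x = 0) ?mulmx0 //.
apply/matrixP=> i j; rewrite ord1 [RHS]mxE; apply/eqP.
by rewrite eq_le x0 andbT hx coord_le_height.
Qed.

(** On the cone every coordinate lies between 0 and the height, so the entries are bounded. *)
Lemma finite_height_le (K : R) :
  finite_set [set x | int_points (cone_of U) x /\ height U x <= K].
Proof.
pose L : R := \sum_i \sum_j `|U i j| * `|K|.
apply: sub_finite_set (finite_bounded_int_points n L).
move=> x [[Cx [z _ zx]] xK]; split=> [|i]; first by exists z.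
have x0 := Cx; move/(cone_of_coord Uu) in x0.
rewrite -[x](mulKVmx Uu) mxE; apply: le_trans (ler_norm_sum _ _ _) _.
rewrite /L [X in _ <= X](bigD1 i) //=; apply: ler_wpDr.
  by apply: sumr_ge0 => i' _; apply: sumr_ge0 => j _; apply: mulr_ge0.
apply: ler_sum => j _; rewrite normrM ler_wpM2l // ger0_norm //.
apply: le_trans (ler_norm K); apply: le_trans xK; exact: coord_le_height.
Qed.

End Height.

Lemma finite_set_argmin (R : realType) (T : eqType) (A : set T) (f : T -> R) :
  finite_set A -> A !=set0 -> exists2 x, A x & forall y, A y -> f x <= f y.
Proof.
move=> /finite_seqP[s ->] {A} [x0]; elim: s x0 => [//|t s IH] x0 _.
case: s IH => [_|t' s IH].
  by exists t => [|y]; rewrite /= ?mem_seq1 // => /eqP->.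
have [x xs xP] := IH t' (mem_head _ _).
have [tx|/ltW xt] := leP (f t) (f x).
  exists t => [|y]; first exact: mem_head.
  by rewrite /= in_cons => /orP[/eqP->//|/xP]; apply: le_trans.
exists x => [|y]; first by rewrite /= in_cons [X in _ || X]xs orbT.
by rewrite /= in_cons => /orP[/eqP->//|/xP].
Qed.

(* A non-generated point of least height is also of least height under the
   generators of the group, hence splits off some [y], a contradiction. *)
Lemma RG_finitely_generated_descent (R : realType) n (U : 'M[R]_n)
    (F : set 'M[int]_n) (M : R) :
  U \in unitmx -> finite_set F -> F `<=` stabilizer (cone_of U) ->
  (forall x, int_points (cone_of U) x ->
     (forall g, F g -> height U x <= height U (act g x)) -> M < height U x ->
     exists2 y, int_points (cone_of U) y &
       [/\ y != 0, y != x & cone_of U (x - y)]) ->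
  RG_finitely_generated (cone_of U).
Proof.
move=> Uu finF FC split_off.
have GG : GLZ_subgroup (smallest (@GLZ_subgroup n) F).
  by apply: GLZ_subgroup_smallest => A /FC[].
have [_ G1 _ GV] := GG.
pose Rgen := [set x | int_points (cone_of U) x /\ height U x <= M].
apply: (@RG_finitely_generated_intro _ _ _ Rgen F) => //.
- exact: finite_height_le.
- by move=> x [].
set S := RG_span _ _.
apply: contrapT => /nonsubset[x0 [Cx0 nSx0]].
(* Bounding the height by that of [x0] makes this set finite, so a lowest element exists. *)
pose bad := [set x | int_points (cone_of U) x /\ height U x <= height U x0]
  `&` ~` S.
have bad0 : bad !=set0 by exists x0.
have [|x [[Cx xx0] nSx] xmin] := finite_set_argmin (height U) _ bad0.
  by apply: finite_setIl; apply: finite_height_le.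
have {}xmin y : int_points (cone_of U) y -> height U y < height U x -> S y.
  move=> Cy yx; apply: contrapT => nSy.
  suff : height U x <= height U y by rewrite leNgt yx.
  apply: xmin; split=> //; split=> //; exact: le_trans (ltW yx) xx0.
have Fx g : F g -> height U x <= height U (act g x).
  move=> Fg; rewrite leNgt; apply/negP => gx.
  have [Gg gC] := FC _ Fg; have [xC [z _ zx]] := Cx.
  apply: nSx; rewrite -[x](actK _ Gg); apply: RG_span_act => //.
    by apply: GV; apply: sub_gen_smallest.
  apply: xmin gx; split; first exact/gC.
  by exists (g *m z) => //; rewrite -act_int zx.
have Mx : M < height U x.
  rewrite ltNge; apply/negP => xM; apply: nSx.
  by rewrite -[x]mulr1n -[x]act1; apply: RG_span_gen.
have [y Cy [y0 yx Cxy]] := split_off x Cx Fx Mx.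
apply: nSx; rewrite -[x](subrK y); apply: RG_spanD; apply: xmin => //.
- have [_ [z _ zx]] := Cx; have [_ [t _ ty]] := Cy.
  by split=> //; exists (z - t) => //; rewrite map_mxB zx ty.
- by rewrite heightB gtrDl oppr_lt0; apply: height_gt0 => //; case: Cy.
- rewrite -subr_gt0 -heightB; apply: height_gt0 => //.
  by rewrite subr_eq0 eq_sym.
Qed.

(** * Eigenvalues of integer matrices *)

(** The order of the indices is free, so that a distinguished one can come first. *)
Lemma big_ord3 (T : Type) (idx : T) (op : Monoid.com_law idx) (i j l : 'I_3)
    (F : 'I_3 -> T) :
  uniq [:: i; j; l] -> \big[op/idx]_k F k = op (F i) (op (F j) (F l)).
Proof.
move=> ijl.
have [||_ E] := @uniq_min_size _ [:: i; j; l] (index_enum 'I_3) ijl.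
- by move=> k; rewrite mem_index_enum.
- by rewrite [index_enum _]unlock -enumT size_enum_ord.
rewrite (perm_big [:: i; j; l]) ?big_cons ?big_nil ?Monoid.mulm1 //.
by rewrite perm_sym; apply: uniq_perm ijl (index_enum_uniq _) E.
Qed.

Lemma ord3_others (i : 'I_3) : exists j l : 'I_3, uniq [:: i; j; l].
Proof.
by exists (ordS i), (ordS (ordS i)); case: i => -[|[|[|]]].
Qed.

Lemma ord3_cover (i j l k : 'I_3) : uniq [:: i; j; l] ->
  [\/ k = i, k = j | k = l].
Proof.
(* The disjunction of [m == k] over all [m] is true and expands to three cases. *)
move=> ijl; have := big_ord3 orb (fun m => m == k) ijl.
rewrite (bigD1 k) //= eqxx orTb => /esym/or3P[]/eqP->;
  by [constructor 1|constructor 2|constructor 3].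
Qed.

(** Rational root theorem: the extreme coefficients are 1 and -1, so numerator and denominator
    divide each other's cubes and both equal 1. *)
Lemma rational_unit_root (t s : int) (q : rat) : 0 < q ->
  q ^+ 3 - t%:~R * q ^+ 2 + s%:~R * q - 1 = 0 -> q = 1.
Proof.
move=> q0; set n := numq q; set d := denq q.
have d0 : d%:~R != 0 :> rat by rewrite intr_eq0 denq_neq0.
have qE : q = n%:~R / d%:~R by rewrite divq_num_den.
rewrite qE => E.
have {}E : n ^+ 3 - t * n ^+ 2 * d + s * n * d ^+ 2 - d ^+ 3 = 0.
  apply/eqP; rewrite -(intr_eq0 rat); apply/eqP.
  rewrite !(rmorphB, rmorphD, rmorphM, rmorphXn) /=.
  have := congr1 (fun x => d%:~R ^+ 3 * x) E; rewrite /= mulr0 => <-; field.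
  exact: d0.
have cop : coprime `|n| `|d| by apply: coprime_num_den.
have d1 : `|d|%N = 1%N.
  have /gcdn_idPr : (`|d| %| `|n| ^ 3)%N.
    rewrite -abszX -dvdzE; apply/dvdzP.
    exists (t * n ^+ 2 - s * n * d + d ^+ 2).
    by apply/eqP; rewrite -subr_eq0; apply/eqP; rewrite -E; ring.
  by have /eqP -> : coprime (`|n| ^ 3) `|d| by rewrite coprimeXl.
have n1 : `|n|%N = 1%N.
  have /gcdn_idPl : (`|n| %| `|d| ^ 3)%N.
    rewrite -abszX -dvdzE; apply/dvdzP.
    exists (n ^+ 2 - t * n * d + s * d ^+ 2).
    by apply/eqP; rewrite -subr_eq0; apply/eqP; rewrite -oppr0 -E; ring.
  by have /eqP -> : coprime `|n| (`|d| ^ 3) by rewrite coprimeXr.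
have -> : d = 1 by rewrite -[LHS]gez0_abs ?d1 ?denq_ge0.
have -> : n = 1 by rewrite -[LHS]gez0_abs ?n1 ?ltW ?numq_gt0.
by rewrite divr1.
Qed.

(** The right side is the characteristic polynomial of a matrix of determinant 1 and trace [t] whose
    inverse has trace [s]. *)
Definition cubic_roots (R : realType) (t s : int) (a : 'I_3 -> R) :=
  forall x, \prod_i (x - a i) = x ^+ 3 - t%:~R * x ^+ 2 + s%:~R * x - 1.

(** A rational root is one of the [a i], hence positive, hence 1. *)
Lemma rational_cubic_root (R : realType) (t s : int) (a : 'I_3 -> R) (q : rat) :
  (forall i, 0 < a i) -> cubic_roots t s a ->
  q ^+ 3 - t%:~R * q ^+ 2 + s%:~R * q - 1 = 0 ->
  q = 1 /\ exists i, a i = 1.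
Proof.
move=> a0 aP E.
have /eqP/prodf_eq0[i _ /eqP/subr0_eq qi] : \prod_i (ratr q - a i) = 0.
  rewrite aP -(ratr_int _ t) -(ratr_int _ s) -(rmorph1 (@ratr R)).
  by rewrite -!rmorphXn -!rmorphM -!(rmorphD, rmorphB) /= E rmorph0.
have q1 : q = 1.
  by apply: rational_unit_root E; rewrite -(ltr0q R) qi.
by split=> //; exists i; rewrite -qi q1 rmorph1.
Qed.

(** If no [a k] is 1, the cubic has no rational root. It is then irreducible over the rationals and
    coprime to every nonzero polynomial of degree at most 2. *)
Lemma quadratic_eigenvalue (R : realType) (t s : int) (a : 'I_3 -> R)
    (p q r : int) i :
  (forall i, 0 < a i) -> cubic_roots t s a ->
  [|| p != 0, q != 0 | r != 0] ->
  p%:~R + q%:~R * a i + r%:~R * a i ^+ 2 = 0 ->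
  exists k, a k = 1.
Proof.
move=> a0 aP pqr E; apply: contrapT => na.
pose P : {poly rat} := Poly [:: -1; s%:~R; - t%:~R; 1].
pose Q : {poly rat} := Poly [:: p%:~R; q%:~R; r%:~R].
have sP : size P = 4%N by rewrite (PolyK (c := 1)) // oner_neq0.
have irrP : irreducible_poly P.
  apply: cubic_irreducible; rewrite ?sP // => x; apply/negP.
  rewrite /root horner_Poly /= => /eqP Ex.
  have [|_] := rational_cubic_root (q := x) a0 aP; last by [].
  by rewrite -Ex; ring.
have Q0 : Q != 0.
  apply: contraTneq pqr => Q0; have Qi k : Q`_k = 0 by rewrite Q0 coef0.
  have := Qi 0%N; have := Qi 1%N; have := Qi 2%N.
  rewrite !coef_Poly /= => /eqP; rewrite intr_eq0 => /eqP ->.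
  by move/eqP; rewrite intr_eq0 => /eqP -> /eqP; rewrite intr_eq0 => /eqP ->.
have copPQ : coprimep P Q.
  rewrite coprimep_def; apply/negPn/negP => sg.
  have := irrP.2 _ sg (dvdp_gcdl P Q) => gP.
  have : P %| Q by rewrite -(eqp_dvdl _ gP) dvdp_gcdr.
  by move/(dvdp_leq Q0); rewrite sP => /leq_trans/(_ (size_Poly _)).
move: copPQ; rewrite -(coprimep_map (@ratr R)).
move/(coprimep_root (x := a i)); rewrite /root !map_Poly !horner_Poly /=.
rewrite !ratr_int !rmorphN rmorph1 /= ratr_int => H.
have : \prod_k (a i - a k) = 0 by rewrite (bigD1 i) //= subrr mul0r.
rewrite aP => Ei.
have /negP[] := H ltac:(by apply/eqP; rewrite -[RHS]Ei; ring).
by apply/eqP; rewrite -[RHS]E; ring.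
Qed.

Lemma diagonalizes_prod1 (R : realType) n (U : 'M[R]_n) A (a : 'I_n -> R) :
  U \in unitmx -> GLZ A -> (forall i, 0 < a i) -> diagonalizes U A a ->
  \prod_i a i = 1.
Proof.
move=> Uu GA a0 dA; have p0 : 0 < \prod_i a i by apply: prodr_gt0.
have := diagonalizes_det Uu dA; move: GA; rewrite /GLZ /= unitmxE.
case/pred2P=> -> E; first by rewrite -E.
by move: p0; rewrite -E; lra.
Qed.

(** The eigenvalues have product 1, so the inverse of each is the product of the other two; the
    second symmetric function is thus the trace of the inverse. *)
Lemma diagonalizes_cubic (R : realType) (U : 'M[R]_3) A (a : 'I_3 -> R) :
  U \in unitmx -> GLZ A -> (forall i, 0 < a i) -> diagonalizes U A a ->
  cubic_roots (\tr A) (\tr (invmx A)) a.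
Proof.
move=> Uu GA a0 dA x; have [j [l ijl]] := ord3_others ord0.
have dV := diagonalizesV GA (fun i => lt0r_neq0 (a0 i)) dA.
have := diagonalizes_prod1 Uu GA a0 dA.
rewrite (diagonalizes_tr Uu dA) (diagonalizes_tr Uu dV) !(big_ord3 _ _ ijl) /=.
set b := a ord0; set c := a j; set d := a l => p1.
have /lt0r_neq0 b0 := a0 ord0; have /lt0r_neq0 c0 := a0 j.
have /lt0r_neq0 d0 := a0 l.
have -> : b^-1 = c * d by apply: (mulfI b0); rewrite p1 divff.
have -> : c^-1 = b * d by apply: (mulfI c0); rewrite mulrCA p1 divff.
have -> : d^-1 = b * c by apply: (mulfI d0); rewrite [RHS]mulrC -mulrA p1 divff.
by rewrite -[X in _ = _ - X]p1; ring.
Qed.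

Lemma double_eigenvalue (R : realType) t s (a : 'I_3 -> R) i j :
  (forall i, 0 < a i) -> cubic_roots t s a -> i != j -> a i = a j ->
  forall k, a k = 1.
Proof.
move=> a0 aP ij aij.
have [l ijl] : exists l, uniq [:: i; j; l].
  have [m [l iml]] := ord3_others i.
  case: (ord3_cover j iml) => E; first by rewrite E eqxx in ij.
    by exists l; rewrite E.
  exists m; rewrite E; move: iml; rewrite /= !inE !negb_or !andbT.
  by move=> /andP[/andP[im il] ml]; rewrite il im eq_sym ml.
have aP' x : (x - a j) * ((x - a j) * (x - a l)) =
    x ^+ 3 - t%:~R * x ^+ 2 + s%:~R * x - 1.
  by rewrite -aP (big_ord3 _ _ ijl) /= aij.
set b := a j in aij aP'; set c := a l in aP'.
have b0 : 0 < b by apply: a0.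
(* Vieta's formulas, from the values at 0, 1 and -1. *)
have E0 : b * b * c = 1 by have := aP' 0; rewrite !expr0n /=; lra.
have Et : t%:~R = b + b + c by have := aP' 1; have := aP' (-1); lra.
have Es : s%:~R = b * b + (b * c + b * c)
  by have := aP' 1; have := aP' (-1); lra.
suff bc1 : b = 1 /\ c = 1.
  by move=> k; case: (ord3_cover k ijl) => ->; rewrite ?aij -/b -/c; case: bc1.
have [bc|bc] := eqVneq b c.
  have : b ^+ 3 == 1 by rewrite -E0 -bc; apply/eqP; ring.
  by rewrite pexpr_eq1 ?ltW // -bc => /eqP.
have D0 : 6 * s%:~R - 2 * t%:~R ^+ 2 != 0 :> R.
  rewrite Es Et (_ : _ - _ = - 2 * (b - c) ^+ 2); last by ring.
  by rewrite mulf_neq0 ?oppr_eq0 ?expf_neq0 ?subr_eq0 ?pnatr_eq0.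
have [q qb] : exists q : rat, ratr q = b.
  (* The common root of the cubic P and its derivative P', from 9 P = (3 x - t) P' + (6 s - 2 t^2) x
     + (t s - 9). *)
  exists ((9 - t%:~R * s%:~R) / (6 * s%:~R - 2 * t%:~R ^+ 2)).
  rewrite fmorph_div /= !(rmorphB, rmorphM, rmorphXn) /= !ratr_int !ratr_nat.
  apply: (mulIf D0); rewrite divfK // Es Et -[9](mulr1 9).
  by rewrite -[X in 9 * X]E0; ring.
have [|q1 _] := @rational_cubic_root R t s a q a0 aP.
  apply: (fmorph_inj (@ratr R)); rewrite rmorph0.
  rewrite !(rmorphB, rmorphD, rmorphM, rmorphXn) /= !ratr_int qb.
  by rewrite rmorph1 -aP' subrr !mul0r.
have b1 : b = 1 by rewrite -qb q1 rmorph1.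
by move: E0; rewrite b1 !mul1r.
Qed.

(** [int_rounding] never lowers a coordinate, so it is applied to the point with all coordinates
    1. *)
Lemma int_interior (R : realType) n (U : 'M[R]_n) : U \in unitmx ->
  exists z : 'cV[int]_n, forall i, 0 < (invmx U *m map_mx intr z) i 0.
Proof.
move=> Uu; have [K _ /(_ (U *m const_mx 1))[z zP]] := int_rounding Uu.
exists z => i; have /andP[+ _] := zP i.
by rewrite mulmxBr mulKmx // [X in 0 <= X]mxE !mxE subr_ge0; apply: lt_le_trans.
Qed.

(** The two height inequalities express that neither [A] nor its inverse lowers a point with
    coordinates [x] and [y]. For lam > 1 each factors as lam - 1 times a linear form, whose sign
    compares [x] with [y]. *)
Lemma balanced_coords (R : realType) (lam mu x y : R) :
  0 < lam -> 0 < mu -> lam * mu = 1 -> lam != 1 -> 0 <= x -> 0 <= y ->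
  x + y <= lam * x + mu * y -> x + y <= mu * x + lam * y ->
  y <= (lam + mu) * x /\ x <= (lam + mu) * y.
Proof.
wlog l1 : lam mu / 1 < lam.
  move=> W l0 m0 lm l1 x0 y0 H1 H2.
  have [?|?] := ltP 1 lam; first exact: W.
  rewrite [lam + mu]addrC; apply: W => //.
  - by rewrite -(ltr_pM2l l0) mulr1 lm lt_neqAle l1.
  - by rewrite mulrC.
  - by apply: contraNneq l1 => m1; rewrite -lm m1 mulr1.
move=> l0 m0 lm _ x0 y0 H1 H2.
have {}H1 : y <= lam * x.
  have : 0 <= (lam - 1) * (x - mu * y).
    rewrite (_ : _ * _ = lam * x + mu * y - x - lam * mu * y); last by ring.
    by rewrite lm mul1r; lra.
  rewrite pmulr_rge0 ?subr_gt0 // subr_ge0 => H.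
  by have := ler_wpM2l (ltW l0) H; rewrite mulrA lm mul1r.
have {}H2 : x <= lam * y.
  have : 0 <= (lam - 1) * (y - mu * x).
    rewrite (_ : _ * _ = lam * y + mu * x - y - lam * mu * x); last by ring.
    by rewrite lm mul1r; lra.
  rewrite pmulr_rge0 ?subr_gt0 // subr_ge0 => H.
  by have := ler_wpM2l (ltW l0) H; rewrite mulrA lm mul1r.
have := mulr_ge0 (ltW m0) x0; have := mulr_ge0 (ltW m0) y0; lra.
Qed.

(** * The case of a fixed ray *)

Lemma int_points_act (R : realType) n (U : 'M[R]_n) B b (z : 'cV[int]_n) :
  U \in unitmx -> diagonalizes U B b -> (forall i, 0 <= b i) ->
  (forall i, 0 <= (invmx U *m map_mx intr z) i 0) ->
  int_points (cone_of U) (act B (map_mx intr z)).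
Proof.
move=> Uu dB b0 z0; split; last by rewrite act_int; exists (B *m z).
by apply/(cone_of_coord Uu) => i; rewrite (coord_act Uu _ _ dB) mulr_ge0.
Qed.

Lemma coordB (R : realType) n (U : 'M[R]_n) (x y : 'cV[R]_n) i :
  (invmx U *m (x - y)) i 0 = (invmx U *m x) i 0 - (invmx U *m y) i 0.
Proof. by rewrite mulmxBr !mxE. Qed.

(* If 1 is an eigenvalue, the others are lam and 1/lam with lam + 1/lam an
   integer tau.  From an interior integer point z one gets y = (A - 1)^2 z in
   the plane of the other two eigenvectors and w = - (A^2 - tau A + 1) z on the
   fixed ray.  A point that is lowest under A and A^-1 has balanced
   coordinates in that plane, so w or y can be subtracted from it. *)
Lemma RG_finitely_generated_fixed_ray (R : realType) (U : 'M[R]_3) A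
    (a : 'I_3 -> R) i :
  U \in unitmx -> GLZ A -> (forall i, 0 < a i) -> injective a ->
  diagonalizes U A a -> a i = 1 ->
  RG_finitely_generated (cone_of U).
Proof.
move=> Uu GA a0 ainj dA ai1; have [j [l ijl]] := ord3_others i.
have dV := diagonalizesV GA (fun i => lt0r_neq0 (a0 i)) dA.
have a1 k : k != i -> a k != 1.
  by apply: contra_neq => ak; apply: ainj; rewrite ak.
have [ji li] : j != i /\ l != i.
  move: ijl; rewrite /= !inE !negb_or !andbT => /andP[/andP[ij il] _].
  by rewrite eq_sym ij eq_sym il.
have jl : a j * a l = 1.
  have := diagonalizes_prod1 Uu GA a0 dA.
  by rewrite (big_ord3 _ _ ijl) /= ai1 mul1r.
set lam := a j in jl; set mu := a l in jl.
have [l0 m0] : 0 < lam /\ 0 < mu by split; apply: a0.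
have l1 : lam != 1 by apply: a1.
have jV : (a j)^-1 = mu.
  by apply: (mulfI (lt0r_neq0 (a0 j))); rewrite divff ?lt0r_neq0.
have lV : (a l)^-1 = lam.
  by apply: (mulfI (lt0r_neq0 (a0 l))); rewrite divff ?lt0r_neq0 // mulrC.
have Etau : (\tr A - 1)%:~R = lam + mu :> R.
  rewrite rmorphB /= (diagonalizes_tr Uu dA) (big_ord3 _ _ ijl) /= ai1.
  by rewrite addrAC subrr add0r.
have [z z0] := int_interior Uu.
have dA1 := diagonalizesD dA (diagonalizesZ (-1) (diagonalizes1 U)).
have dY := diagonalizesM dA1 dA1.
have dW := diagonalizesD (diagonalizesZ (-1) (diagonalizesM dA dA))
  (diagonalizesD (diagonalizesZ (\tr A - 1) dA)
                 (diagonalizesZ (-1) (diagonalizes1 U))).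
set Y := (X in diagonalizes U X _) in dY.
set W := (X in diagonalizes U X _) in dW.
set ey := (X in diagonalizes _ _ X) in dY.
set ew := (X in diagonalizes _ _ X) in dW.
have eyE k : ey k = (a k - 1) ^+ 2 by rewrite /ey rmorphN1; ring.
have ewE k : ew k = - a k ^+ 2 + (lam + mu) * a k - 1.
  by rewrite /ew rmorphN1 Etau; ring.
have ewj : ew j = 0 by rewrite ewE -/lam -jl; ring.
have ewl : ew l = 0 by rewrite ewE -/mu -jl; ring.
(* At eigenvalue 1 this is lam + mu - 2, positive because lam * mu = 1 and lam is not 1. *)
have ewi : 0 < ew i.
  have -> : ew i = (lam - 1) ^+ 2 * mu.
    have -> : (lam - 1) ^+ 2 * mu = (lam - 2) * (lam * mu) + mu by ring.
    by rewrite ewE ai1 jl; ring.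
  by rewrite mulr_gt0 // exprn_even_gt0 //= subr_eq0.
have ew0 k : 0 <= ew k.
  by case: (ord3_cover k ijl) => ->; rewrite ?ewj ?ewl // ltW.
have ey0 k : 0 <= ey k by rewrite eyE sqr_ge0.
set zr : 'cV[R]_3 := map_mx intr z in z0.
pose y := act Y zr; pose w := act W zr.
have cy k : (invmx U *m y) k 0 = ey k * (invmx U *m zr) k 0.
  exact: coord_act.
have cw k : (invmx U *m w) k 0 = ew k * (invmx U *m zr) k 0.
  exact: coord_act.
have Cy : int_points (cone_of U) y.
  by apply: int_points_act dY ey0 _ => // k; apply: ltW.
have Cw : int_points (cone_of U) w.
  by apply: int_points_act dW ew0 _ => // k; apply: ltW.
have yi : (invmx U *m y) i 0 = 0 by rewrite cy eyE ai1 subrr expr0n mul0r.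
have wj : (invmx U *m w) j 0 = 0 by rewrite cw ewj mul0r.
have wl : (invmx U *m w) l 0 = 0 by rewrite cw ewl mul0r.
have yj : 0 < (invmx U *m y) j 0.
  by rewrite cy mulr_gt0 // eyE exprn_even_gt0 //= subr_eq0.
have yl : 0 < (invmx U *m y) l 0.
  by rewrite cy mulr_gt0 // eyE exprn_even_gt0 //= subr_eq0 a1.
have wi : 0 < (invmx U *m w) i 0 by rewrite cw mulr_gt0.
have hE x : height U x = (invmx U *m x) i 0 +
    ((invmx U *m x) j 0 + (invmx U *m x) l 0).
  by rewrite /height (big_ord3 _ _ ijl).
(* If [w] cannot be subtracted, the fixed coordinate is below [height U w], so the other two sum to
   more than (1 + lam + mu) times [height U y]. By balance each is at most lam + mu times the other,
   so both exceed those of [y]. *)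
apply: (@RG_finitely_generated_descent _ _ U [set A; invmx A]
  (height U w + (1 + (lam + mu)) * height U y)) => //.
- move=> g [->|->]; first exact: diagonalizes_stabilizer dA.
  apply: (diagonalizes_stabilizer Uu _ _ dV) => [|k]; last by rewrite invr_gt0.
  by rewrite /GLZ /= unitmx_inv.
move=> x [Cx _] xmin Mx; have x0 := Cx; move/(cone_of_coord Uu) in x0.
have n0 (v : 'cV[R]_3) k : 0 < (invmx U *m v) k 0 -> v != 0.
  by apply: contraTneq => ->; rewrite mulmx0 mxE ltxx.
have hy0 : 0 < height U y by rewrite hE yi add0r addr_gt0.
have hw0 : 0 < height U w by rewrite hE wj wl !addr0.
have lmy : 0 < (lam + mu) * height U y by rewrite mulr_gt0 // addr_gt0.
have [xw|xw] := leP ((invmx U *m w) i 0) ((invmx U *m x) i 0).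
  exists w => //; split; first exact: n0 wi.
    by apply: contraTneq Mx => <-; rewrite -leNgt mulrDl mul1r; lra.
  apply/(cone_of_coord Uu) => k; rewrite coordB.
  by case: (ord3_cover k ijl) => ->; rewrite ?wj ?wl ?subr0 ?subr_ge0.
exists y => //; split; first exact: n0 yj.
  apply: contraTneq Mx => <-; rewrite -leNgt mulrDl mul1r; lra.
have [] := @balanced_coords R lam mu
    ((invmx U *m x) j 0) ((invmx U *m x) l 0) => //.
- have := xmin A (or_introl erefl).
  by rewrite !hE !(coord_act Uu _ _ dA) ai1 mul1r lerD2l.
- have := xmin (invmx A) (or_intror erefl).
  rewrite !hE !(coord_act Uu _ _ dV) ai1 invr1 mul1r jV lV.
  by rewrite lerD2l.
move=> bl bj; move: Mx.
rewrite (hE x) (hE w) (hE y) wj wl yi !addr0 add0r => Mx.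
have lmyj : 0 < (lam + mu) * (invmx U *m y) j 0 by rewrite mulr_gt0 // addr_gt0.
have lmyl : 0 < (lam + mu) * (invmx U *m y) l 0 by rewrite mulr_gt0 // addr_gt0.
apply/(cone_of_coord Uu) => k; rewrite coordB.
case: (ord3_cover k ijl) => ->; first by rewrite yi subr0.
  rewrite subr_ge0 leNgt; apply/negP => xy.
  have := ler_wpM2l (ltW (addr_gt0 l0 m0)) (ltW xy); lra.
rewrite subr_ge0 leNgt; apply/negP => xy.
have := ler_wpM2l (ltW (addr_gt0 l0 m0)) (ltW xy); lra.
Qed.

(** * Units of an irreducible matrix *)

Section Units.
Variables (R : realType) (U : 'M[R]_3) (A : 'M[int]_3) (a : 'I_3 -> R).
Hypotheses (Uu : U \in unitmx) (dA : diagonalizes U A a).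
Hypothesis a0 : forall i, 0 < a i.
Hypothesis quad_neq0 : forall (p q r : int) i,
  [|| p != 0, q != 0 | r != 0] ->
  p%:~R + q%:~R * a i + r%:~R * a i ^+ 2 != 0.

(* Pigeonhole on p + q A + r A^2 with 0 <= p, q, r <= m^2: there are more than
   m^6 of them, and m^3 boxes of width c/m for each of two eigenvalues. *)
Lemma small_quadratic (j : 'I_3) : exists2 c : R, 0 < c &
  forall m, (0 < m)%N -> exists p q r : int,
    let b k := p%:~R + q%:~R * a k + r%:~R * a k ^+ 2 in
    [/\ [|| p != 0, q != 0 | r != 0],
        forall k, k != j -> `|b k| <= c / m%:R & `|b j| <= c * m%:R ^+ 2].
Proof.
(* With coefficients in [0, m^2] the value at [a k] is at most [s k] times m^2; [c] exceeds every
   [s k]. *)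
pose s k := 1 + a k + a k ^+ 2.
have s0 k : 0 < s k by rewrite /s !addr_gt0 ?exprn_gt0.
pose c := 1 + \sum_k s k.
have sc k : s k < c.
  rewrite /c (bigD1 k) //= addrCA ltrDl ltr_wpDr //.
  by apply: sumr_ge0 => k' _; apply: ltW.
have c0 : 0 < c := lt_trans (s0 j) (sc j).
exists c => // m m0; have mR : 0 < m%:R :> R by rewrite ltr0n.
pose T := ('I_(m ^ 2).+1 * 'I_(m ^ 2).+1 * 'I_(m ^ 2).+1)%type.
pose be (x : T) k : R := x.1.1%:R + x.1.2%:R * a k + x.2%:R * a k ^+ 2.
have be0 x k : 0 <= be x k.
  by rewrite /be !addr_ge0 // mulr_ge0 // ?exprn_ge0 // ltW.
have o2 (o : 'I_(m ^ 2).+1) : (o : nat)%:R <= m%:R ^+ 2 :> R.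
  by rewrite -natrX ler_nat -ltnS.
have be1 x k : be x k < c * m%:R ^+ 2.
  apply: (@le_lt_trans _ _ (s k * m%:R ^+ 2)); last first.
    by rewrite ltr_pM2r // exprn_gt0.
  rewrite /s !mulrDl mul1r; apply: lerD; first apply: lerD => //.
    by rewrite mulrC ler_wpM2l // ltW.
  by rewrite mulrC ler_wpM2l // exprn_ge0 // ltW.
have [i [l jil]] := ord3_others j.
have m3 : (0 < m ^ 3)%N by rewrite expn_gt0 m0.
(* The index of the box of width c/m containing [be x k], below m^3 because [be x k] is below c
   m^2. *)
pose t x k := Num.truncn (be x k * m%:R / c).
have bm0 x k : 0 <= be x k * m%:R / c by rewrite !mulr_ge0 ?invr_ge0 // ltW.
have t3 x k : (t x k < (m ^ 3).-1.+1)%N.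
  rewrite prednK // truncn_lt_nat // ltr_pdivrMr // natrX exprSr.
  by rewrite mulrAC [_ ^+ 2 * c]mulrC ltr_pM2r.
pose f (x : T) : 'I_(m ^ 3).-1.+1 * 'I_(m ^ 3).-1.+1 :=
  (Ordinal (t3 x i), Ordinal (t3 x l)).
have /injectivePn[x [y xy fxy]] : ~~ injectiveb f.
  apply/negP => /injectiveP/leq_card.
  rewrite !card_prod !card_ord prednK // leqNgt -expnD => /negP; apply.
  rewrite (_ : (3 + 3 = 2 * 3)%N) // expnM.
  have -> n : (n * n * n = n ^ 3)%N by rewrite !expnS expn0 muln1 mulnA.
  by rewrite ltn_exp2r.
have fk k : k != j -> t x k = t y k.
  case: (ord3_cover k jil) => ->; rewrite ?eqxx // => _.
    by have /(congr1 (fun u => val u.1)) := fxy.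
  by have /(congr1 (fun u => val u.2)) := fxy.
exists (x.1.1%:Z - y.1.1%:Z), (x.1.2%:Z - y.1.2%:Z), (x.2%:Z - y.2%:Z) => b.
have bE k : b k = be x k - be y k by rewrite /b /be !rmorphB /=; ring.
split.
- apply: contraNT xy; rewrite !negb_or !negbK !subr_eq0 !eqz_nat.
  case: (x) (y) => [[x1 x2] x3] [[y1 y2] y3] /= /and3P[/eqP e1 /eqP e2 /eqP e3].
  by apply/eqP; congr (_, _, _); apply: val_inj.
- move=> k kj; rewrite bE; have := fk k kj; rewrite /t => E.
  have /andP[x1 x2] := truncn_itv (bm0 x k).
  have /andP[y1 y2] := truncn_itv (bm0 y k).
  rewrite E in x1 x2; move: x1 x2 y1 y2; rewrite -!natr1.
  set n := (Num.truncn _)%:R; move=> x1 x2 y1 y2.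
  have : `|(be x k - be y k) * m%:R / c| <= 1.
    by rewrite !mulrBl ler_norml; apply/andP; split; lra.
  rewrite !normrM normfV (gtr0_norm c0) (gtr0_norm mR) ler_pdivrMr // mul1r.
  by rewrite ler_pdivlMr.
- rewrite bE ler_norml.
  have := be0 x j; have := be0 y j; have := be1 x j; have := be1 y j.
  by move=> *; apply/andP; split; lra.
Qed.

(** Two eigenvalues are at most c/m and the third at most c m^2, so the determinant is bounded by
    c^3 for every m, and m may be taken beyond c/d. *)
Lemma small_elements (j : 'I_3) : exists D : nat, forall d : R, 0 < d ->
  exists B b, [/\ diagonalizes U B b, forall k, b k != 0,
    forall k, k != j -> `|b k| <= d & (`|\det B| <= D)%N].
Proof.
have [c c0 H] := small_quadratic j.
exists (Num.truncn (c ^+ 3)) => d d0; pose m := (Num.truncn (c / d)).+1.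
have [p [q [r [pqr bs bj]]]] := H m isT.
pose b k := p%:~R + q%:~R * a k + r%:~R * a k ^+ 2.
have mR : 0 < m%:R :> R by rewrite ltr0n.
pose B := p *: 1%:M + q *: A + r *: (A *m A).
have dB : diagonalizes U B b.
  have := diagonalizesD (diagonalizesD (diagonalizesZ p (diagonalizes1 U))
    (diagonalizesZ q dA)) (diagonalizesZ r (diagonalizesM dA dA)).
  by congr diagonalizes; apply/funext => k; rewrite /b mulr1 expr2.
exists B, b; split=> // [k|k kj|]; first exact: quad_neq0.
  apply: le_trans (bs k kj) _; rewrite ler_pdivrMr // mulrC -ler_pdivrMr //.
  by rewrite ltW // truncnS_gt.
rewrite truncn_ge_nat ?exprn_ge0 ?(ltW c0) //.
rewrite pmulrn abszE intr_norm (diagonalizes_det Uu dB) normr_prod.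
have [i [l jil]] := ord3_others j.
have [ij lj] : i != j /\ l != j.
  move: jil; rewrite /= !inE !negb_or !andbT => /andP[/andP[ij il] _].
  by rewrite eq_sym ij eq_sym il.
rewrite (big_ord3 _ _ jil) /=.
have -> : c ^+ 3 = c * m%:R ^+ 2 * (c / m%:R * (c / m%:R)).
  by field; rewrite lt0r_neq0.
apply: ler_pM => //; first exact: mulr_ge0.
by apply: ler_pM => //; apply: bs.
Qed.

End Units.

(** If each class failed at some positive bound, an element for the least of these finitely many
    bounds would belong to no class. *)
Lemma finite_class_pigeonhole (R : realType) (X : Type) (T : finType)
    (cl : X -> T) (P : R -> X -> Prop) :
  (forall d d' x, d <= d' -> P d x -> P d' x) ->
  (forall d, 0 < d -> exists x, P d x) ->
  exists t, forall d, 0 < d -> exists2 x, P d x & cl x = t.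
Proof.
move=> Pmono Pex; apply: contrapT => /forallNP nt.
have /choice[d dP] : forall t, exists d, 0 < d /\ forall x, P d x -> cl x <> t.
  move=> t; apply: contrapT => /forallNP nd; apply: (nt t) => d d0.
  apply: contrapT => nx; apply: (nd d); split=> // x Px xt.
  by apply: nx; exists x.
have [x1 _] := Pex 1 ltr01.
have [||t0 _ t0min] := @finite_set_argmin R T [set: T] d.
- exact: finite_finset.
- by exists (cl x1).
have [x Px] := Pex _ (dP t0).1.
by apply: (dP (cl x)).2 erefl; apply: Pmono Px; apply: t0min.
Qed.

(* With d = det B and B' = B + d K, the quotient B' B^-1 = 1 + K (\adj B) is
   integral. *)
Lemma congruent_quotient (R : realType) n (U : 'M[R]_n) (B B' : 'M[int]_n)
    (b b' : 'I_n -> R) :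
  diagonalizes U B b -> diagonalizes U B' b' -> (forall k, b k != 0) ->
  \det B != 0 -> `|\det B|%N = `|\det B'|%N ->
  (forall i l, (\det B %| B' i l - B i l)%Z) ->
  exists2 g, GLZ g & diagonalizes U g (fun k => b' k / b k).
Proof.
move=> dB dB' b0 d0 dd BB.
pose K := \matrix_(i, l) ((B' i l - B i l) %/ \det B)%Z.
have EB : B' = B + \det B *: K.
  by apply/matrixP=> i l; rewrite !mxE mulrC divzK // addrC subrK.
pose g := 1%:M + K *m \adj B.
have gB : g *m B = B'.
  by rewrite mulmxDl mul1mx -mulmxA mul_adj_mx mul_mx_scalar EB.
exists g.
  have : \det g * \det B = \det B' by rewrite -det_mulmx gB.
  move/(congr1 absz); rewrite abszM -dd => /eqP.
  rewrite -{2}[`|\det B|%N]mul1n eqn_pmul2r ?absz_gt0 // => /eqP g1.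
  by rewrite /GLZ /= unitmxE; move: g1; case: (\det g) => -[|[|m]].
move=> k; apply: (scalerI (b0 k)); rewrite -actZ -dB -actM gB dB' scalerA.
by rewrite mulrC divfK.
Qed.

(** Matrices from [small_elements] with equal |det| and congruent entries have a unit as quotient.
    Taking the second much smaller than the first makes it contract away from [j]. *)
Lemma contracting_unit (R : realType) (U : 'M[R]_3) (A : 'M[int]_3)
    (a : 'I_3 -> R) (j : 'I_3) :
  U \in unitmx -> diagonalizes U A a -> (forall i, 0 < a i) ->
  (forall (p q r : int) i, [|| p != 0, q != 0 | r != 0] ->
     p%:~R + q%:~R * a i + r%:~R * a i ^+ 2 != 0) ->
  exists g e, [/\ GLZ g, diagonalizes U g e, forall k, 0 < e k &
                  forall k, k != j -> e k <= 4^-1].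
Proof.
move=> Uu dA a0 quad; have [D sm] := small_elements Uu dA a0 quad j.
pose P (d : R) (x : 'M[int]_3 * ('I_3 -> R)) :=
  [/\ diagonalizes U x.1 x.2, forall k, x.2 k != 0,
    forall k, k != j -> `|x.2 k| <= d & (`|\det x.1| <= D)%N].
(* The class records |det| and the entries modulo the determinant; [inord] loses nothing as long as
   |det| is at most [D]. *)
pose cl (x : 'M[int]_3 * ('I_3 -> R)) :
    'I_D.+1 * 'M['I_D.+1]_3 :=
  (inord (absz (\det x.1)),
   \matrix_(i, l) inord (absz (x.1 i l %% \det x.1)%Z)).
have [||t tP] := @finite_class_pigeonhole R _ _ cl P.
- move=> d d' x dd' [dx x0 xd xD]; split=> // k kj.
  exact: le_trans (xd k kj) dd'.
- by move=> d /sm[B [b H]]; exists (B, b).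
have [[B b] [/= dB b0 _ BD] clB] := tP 1 ltr01.
(* Half the smaller of the two eigenvalues of [B] away from [j], so that the quotients are at most
   1/2. *)
pose d := Num.min `|b (ordS j)| `|b (ordS (ordS j))| / 2.
have dk k : k != j -> d <= `|b k| / 2.
  have jil : uniq [:: j; ordS j; ordS (ordS j)] by case: (j) => -[|[|[|]]].
  rewrite /d ler_pM2r ?invr_gt0 // ge_min.
  by case: (ord3_cover k jil) => ->; rewrite ?eqxx // lexx ?orbT.
have d0 : 0 < d by rewrite divr_gt0 // lt_min !normr_gt0 !b0.
have [[B' b'] [/= dB' b0' bd' BD'] clB'] := tP d d0.
have [/(congr1 val)/= dd /matrixP mm] : (cl (B, b)).1 = (cl (B', b')).1 /\
    (cl (B, b)).2 = (cl (B', b')).2 by rewrite clB clB'.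
rewrite /= !inordK // in dd.
have det0 : \det B != 0.
  rewrite -(intr_eq0 R) (diagonalizes_det Uu dB).
  exact/prodf_neq0.
have [|g Gg dg] := congruent_quotient dB dB' b0 det0 dd.
  move=> i l; rewrite -eqz_mod_dvd eq_sym; apply/eqP.
  have := mm i l; rewrite !mxE => /(congr1 val)/=.
  have mD (C : 'M[int]_3) : \det C != 0 -> (`|\det C| <= D)%N ->
      (absz (C i l %% \det C)%Z < D.+1)%N.
    move=> C0 CD; rewrite ltnS; apply: leq_trans CD.
    by rewrite -lez_nat gez0_abs ?modz_ge0 // ltW // ltz_mod.
  have det0' : \det B' != 0 by rewrite -absz_gt0 -dd absz_gt0.
  rewrite !inordK ?mD // => /(congr1 Posz).
  rewrite !gez0_abs ?modz_ge0 // => ->.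
  by rewrite -modz_abs -[in RHS]modz_abs dd.
have b'b k : b' k / b k != 0 by rewrite mulf_neq0 ?invr_eq0.
(* Squaring makes the eigenvalues positive and turns 1/2 into 1/4. *)
exists (g *m g), (fun k => (b' k / b k) * (b' k / b k)); split.
- by rewrite /GLZ /= unitmx_mul Gg.
- exact: diagonalizesM.
- by move=> k; rewrite -expr2 exprn_even_gt0 //=.
move=> k kj; rewrite -expr2 -real_normK ?num_real //.
have : `|b' k / b k| <= 2^-1.
  rewrite normrM normfV ler_pdivrMr ?normr_gt0 // mulrC.
  exact: le_trans (bd' k kj) (dk k kj).
move=> H; rewrite (_ : 4^-1 = 2^-1 ^+ 2); last by field.
by rewrite ler_pXn2r ?nnegrE ?invr_ge0.
Qed.

(* A point that is lowest under the three contracting units has all its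
   coordinates comparable to its height. *)
Lemma RG_finitely_generated_irreducible (R : realType) (U : 'M[R]_3)
    (A : 'M[int]_3) (a : 'I_3 -> R) :
  U \in unitmx -> diagonalizes U A a -> (forall i, 0 < a i) ->
  (forall (p q r : int) i, [|| p != 0, q != 0 | r != 0] ->
     p%:~R + q%:~R * a i + r%:~R * a i ^+ 2 != 0) ->
  RG_finitely_generated (cone_of U).
Proof.
move=> Uu dA a0 quad.
have /choice[g /choice[e gP]] : forall j, exists g, exists e : 'I_3 -> R,
    [/\ GLZ g, diagonalizes U g e, forall k, 0 < e k &
        forall k, k != j -> e k <= 4^-1].
  by move=> j; apply: contracting_unit dA _ _.
have [z z0] := int_interior Uu; set zr : 'cV[R]_3 := map_mx intr z in z0.
have Cz : cone_of U zr by apply/(cone_of_coord Uu) => i; apply: ltW.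
have zn0 : zr != 0.
  by have := z0 ord0; apply: contraTneq => ->; rewrite mulmx0 mxE ltxx.
have hz := height_gt0 Uu Cz zn0.
pose K := \sum_j e j j.
have eK j : e j j <= K.
  rewrite /K (bigD1 j) //= lerDl sumr_ge0 // => k _.
  by have [_ _ e0 _] := gP k; apply: ltW.
have K0 : 0 < K by have [_ _ e0 _] := gP ord0; apply: lt_le_trans (eK ord0).
have hKz := mulr_gt0 K0 hz.
(* Lowness under [g j] gives 3/4 of the height of [x] as a lower bound for [K] times its coordinate
   [j]. Above this threshold that coordinate exceeds the height of [zr], up to the factor 3/2 to
   spare. *)
apply: (@RG_finitely_generated_descent _ _ U (range g)
  ((2 * K + 1) * height U zr)) => //.
- by apply: finite_image; apply: finite_finset.
- move=> _ [j _ <-]; have [Gg dg e0 _] := gP j.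
  exact: diagonalizes_stabilizer dg.
move=> x [Cx _] xmin Mx; have x0 := Cx; move/(cone_of_coord Uu) in x0.
exists zr; first by split=> //; exists z.
split=> //; first by apply: contraTneq Mx => <-; rewrite -leNgt; lra.
apply/(cone_of_coord Uu) => j; rewrite coordB subr_ge0.
have [Gg dg e0 ej] := gP j.
have : height U x <= e j j * (invmx U *m x) j 0 + 4^-1 * height U x.
  apply: le_trans (xmin (g j) _) _; first by exists j.
  rewrite /height mulr_sumr.
  rewrite (bigD1 j) //= [X in _ <= _ + X](bigD1 j) //= (coord_act Uu _ _ dg).
  rewrite addrA; apply: lerD; first by rewrite lerDl mulr_ge0 // invr_ge0.
  apply: ler_sum => k kj; rewrite (coord_act Uu _ _ dg).
  by rewrite ler_wpM2r // ej.
have := ler_wpM2r (x0 j) (eK j).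
have := ler_wpM2l (ltW K0) (coord_le_height Uu j Cz).
by move=> H1 H2 H3; rewrite -(ler_pM2l K0); lra.
Qed.

(** * Cones spanned by eigenvectors *)

Definition cols_mx (R : realType) n k (u : 'I_k -> 'cV[R]_n) : 'M[R]_(n, k) :=
  \matrix_(i, j) u j i 0.

Lemma col_cols_mx (R : realType) n k (u : 'I_k -> 'cV[R]_n) j :
  col j (cols_mx u) = u j.
Proof. by apply/matrixP=> i l; rewrite !mxE ord1. Qed.

Lemma cone_of_cols_mx (R : realType) n k (u : 'I_k -> 'cV[R]_n) :
  cone_of (cols_mx u) = conic u.
Proof.
by rewrite cone_ofE; congr conic; apply/funext => j; rewrite col_cols_mx.
Qed.

Lemma distinct_eigenvectors_unit (R : realType) (A : 'M[int]_3)
    (a : 'I_3 -> R) (u : 'I_3 -> 'cV[R]_3) :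
  injective a -> (forall i, eigenvector A (a i) (u i)) ->
  cols_mx u \in unitmx.
Proof.
move=> ainj Au; rewrite -unitmx_tr -row_free_unit; apply: inj_row_free => v.
move/(congr1 trmx); rewrite trmx_mul trmxK trmx0 mulmx_col_scale => v0.
(* Applying [A] minus the scalar [a m] to a linear relation kills its term [m]; doing so for [j] and
   [l] isolates term [i]. *)
have shift (w : 'I_3 -> R) m : \sum_k w k *: u k = 0 ->
    \sum_k (w k * (a k - a m)) *: u k = 0.
  move=> w0; have := congr1 (fun x => act A x - a m *: x) w0.
  rewrite /act mulmx0 scaler0 subr0 => E.
  rewrite -[RHS]E mulmx_sumr scaler_sumr -sumrB; apply: eq_bigr => k _.
  have [_ /= Ak] := Au k.
  rewrite -scalemxAr -/(act A (u k)) Ak !scalerA -scalerBl.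
  by congr (_ *: _); ring.
apply/matrixP=> r i; rewrite ord1 [RHS]mxE.
have [j [l ijl]] := ord3_others i.
have /(shift _ j)/(shift _ l) : \sum_k v 0 k *: u k = 0.
  by rewrite -[RHS]v0; apply: eq_bigr => k _; rewrite col_cols_mx mxE.
rewrite (big_ord3 _ _ ijl) /= !subrr mulr0 mul0r mulr0 !scale0r !addr0.
have [/negPf ui0 _] := Au i.
move/eqP; rewrite scaler_eq0 ui0 orbF !mulf_eq0 !subr_eq0 !(inj_eq ainj).
move: ijl; rewrite /= !inE !negb_or !andbT => /andP[/andP[/negPf-> /negPf->] _].
by rewrite !orbF => /eqP.
Qed.

Lemma eigenrays_RG_finitely_generated (R : realType) (C : set 'cV[R]_3) :
  polyhedral_cone C -> pointed C -> simple_with_eigenrays C ->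
  RG_finitely_generated C.
Proof.
move=> Cpol Cpt [_ [u [Cu [A [a [GA _ ainj Au]]]]]].
have [k [v [Cv v0 vext _]]] := minimal_generators Cpol Cpt.
(* Both [v] and [u] run through the extreme rays, so they generate the same cone. *)
have -> : C = cone_of (cols_mx u).
  rewrite cone_of_cols_mx Cv; apply/seteqP; split; apply: conic_ray_sub => i.
    have := vext i; rewrite Cu => -[j _ E]; exists j.
    by rewrite E; apply: ray_refl.
  have [j E] : exists j, ray (u i) = ray (v j).
    by apply: extreme_ray_gen; rewrite -Cv Cu; exists i.
  by exists j; rewrite -E; apply: ray_refl.
have Uu : cols_mx u \in unitmx.
  by apply: (@distinct_eigenvectors_unit _ A a) => // i; case: (Au i).
have a0 i : 0 < a i by case: (Au i).
have dA : diagonalizes (cols_mx u) A a.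
  by move=> i; rewrite col_cols_mx; case: (Au i) => _ [].
have [[i ai1]|na1] := pselect (exists i, a i = 1).
  exact: RG_finitely_generated_fixed_ray dA ai1.
apply: (RG_finitely_generated_irreducible Uu dA a0) => p q r i pqr.
apply/eqP => E; apply: na1.
exact: quadratic_eigenvalue a0 (diagonalizes_cubic Uu GA a0 dA) pqr E.
Qed.

(** * Necessity *)

Lemma extreme_rays_act (R : realType) n (C : set 'cV[R]_n) g u :
  stabilizer C g -> extreme_rays C (ray u) -> extreme_rays C (ray (act g u)).
Proof.
move=> [Gg gC] [w [w0 Cw uw wext]].
have rayV x y : ray (act g x) y -> ray x (act (invmx g) y).
  by move=> [c c0 ->]; exists c => //; rewrite actZ actK.
have u0 : u != 0.
  have [c c0 ->] : ray w u by rewrite -uw; apply: ray_refl.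
  by rewrite scaler_eq0 (negPf w0) gt_eqF.
have rayg x y : ray x y -> ray (act g x) (act g y).
  by move=> [c c0 ->]; exists c => //; rewrite actZ.
have [c c0 Ew] : ray u w by rewrite uw; apply: ray_refl.
have Egu : ray (act g u) = ray (act g w).
  by apply: ray_eq; apply: rayg; exists c.
exists (act g w); split=> //.
- by apply: contra_neq w0 => E; rewrite -[w](actK _ Gg) E /act mulmx0.
- exact/gC.
rewrite Egu => x y Cx Cy /rayV; rewrite actD.
have CV z : C z -> C (act (invmx g) z) by move=> Cz; apply/gC; rewrite actVK.
have back z : act (invmx g) z = 0 \/ ray u (act (invmx g) z) ->
    z = 0 \/ ray (act g w) z.
  case=> [z0|/rayg]; first by left; rewrite -[z](actVK _ Gg) z0 /act mulmx0.
  by rewrite actVK // Egu; right.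
rewrite -uw => /(wext _ _ (CV x Cx) (CV y Cy))[xP yP].
by split; apply: back.
Qed.

(** The generators span because the independent vectors of the cone are combinations of them;
    [fullrankfun] extracts a basis. *)
Lemma full_dimensional_basis (R : realType) n k (v : 'I_k -> 'cV[R]_n) :
  full_dimensional (conic v) ->
  exists f : 'I_n -> 'I_k, cols_mx (fun i => v (f i)) \in unitmx.
Proof.
move=> [W Wu WC].
have Vfull : row_full (cols_mx v)^T.
  rewrite -sub1mx; apply: (@submx_trans _ _ _ _ _ _ W^T).
    by rewrite sub1mx row_full_unit unitmx_tr.
  apply/row_subP => i; rewrite -tr_col.
  have [c _ ->] := WC i; rewrite (_ : \sum_j _ = cols_mx v *m \col_j c j).
    by rewrite trmx_mul submxMl.
  rewrite mulmx_col_scale; apply: eq_bigr => j _.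
  by rewrite col_cols_mx mxE.
exists (fullrankfun Vfull); rewrite -unitmx_tr -row_full_unit.
have := fullrowsub_full Vfull; congr row_full.
by apply/matrixP=> i j; rewrite !mxE.
Qed.

(* By Farkas, an extreme ray missed by the generators is separated from all
   integer points of the cone, although some of them follow it at bounded
   distance. *)
Lemma finite_generation_rational (R : realType) n m (C : set 'cV[R]_n)
    (w : 'I_m -> 'cV[R]_n) :
  polyhedral_cone C -> full_dimensional C ->
  (forall i, int_points C (w i)) -> int_points C `<=` conic w ->
  all_rays_rational C.
Proof.
move=> [k [V CV]] [W Wu WC] wC Cw r rC; rewrite cone_ofE in CV.
have [u [u0 Cu Er _]] := rC.
(* If [u] is a combination of the generators, extremality puts one of them, an integer vector, on
   the ray. *)
have [[c c0 Eu]|nwu] := pselect (conic w u).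
  have [|||i] := @extreme_ray_summand _ _ _ (fun i => col i V) r _
    (fun i => c i *: w i).
  - by rewrite -CV.
  - by rewrite -Eu Er; apply: ray_refl.
  - by move=> i; apply: conicZ => //; rewrite -CV; case: (wC i).
  rewrite Er => /(ray_unscale u0 (c0 i))/ray_eq->.
  have [_ [z _ <-]] := wC i; exists (map_mx intr z); congr ray.
  by apply/matrixP=> a b; rewrite !mxE ratr_int.
have [l lw lu] := farkas nwu.
have lS s : int_points C s -> 0 <= (l *m s) 0 0.
  move/Cw => [c c0 ->]; rewrite mulmx_sumr summxE; apply: sumr_ge0 => i _.
  by rewrite -scalemxAr mxE mulr_ge0.
have [K K0 KP] := int_rounding Wu.
pose L : R := \sum_j `|(l *m col j W) 0 0| * K.
have L0 : 0 <= L by apply: sumr_ge0 => j _; apply: mulr_ge0.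
(* The functional is -(L + 1) at [t *: u], and rounding to an integer point of [C] adds at most
   [L]. *)
pose t := (L + 1) / - (l *m u) 0 0.
have t0 : 0 < t by rewrite divr_gt0 ?oppr_gt0 // ltr_wpDl.
have [z zP] := KP (t *: u); set y := invmx W *m _ in zP.
have Ez : map_mx intr z = t *: u + \sum_j y j 0 *: col j W.
  by rewrite -mulmx_col_scale mulKVmx // addrC subrK.
have Cz : int_points C (map_mx intr z).
  split; last by exists z.
  rewrite Ez CV; apply: conicD; first by apply: conicZ; rewrite -?CV // ltW.
  apply: conic_sum => j _; have /andP[y0 _] := zP j.
  by apply: conicZ => //; rewrite -CV.
have := lS _ Cz; rewrite Ez mulmxDr mxE -scalemxAr mxE mulmx_sumr summxE.
have -> : t * (l *m u) 0 0 = - (L + 1).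
  by rewrite /t invrN mulrN mulNr divfK // lt_eqF.
have : \sum_i (l *m (y i 0 *: col i W)) 0 0 <= L.
  apply: ler_sum => j _; have /andP[y0 yK] := zP j.
  rewrite -scalemxAr mxE mulrC; apply: le_trans (ler_norm _) _.
  by rewrite normrM ler_wpM2l // ger0_norm.
lra.
Qed.

(** Every generator is an eigenvector and the eigenvalues on the basis are distinct, so it has a
    single nonzero coordinate and lies on one of the three basis rays. *)
Lemma eigenbasis_simple_with_eigenrays (R : realType) (C : set 'cV[R]_3) k
    (v : 'I_k -> 'cV[R]_3) (f : 'I_3 -> 'I_k) (A : 'M[int]_3)
    (mu : 'I_k -> R) :
  pointed C -> C = conic v -> (forall i, v i != 0) ->
  (forall i, extreme_rays C (ray (v i))) ->
  cols_mx (fun i => v (f i)) \in unitmx -> GLZ A ->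
  (forall i, 0 < mu i) -> (forall i, act A (v i) = mu i *: v i) ->
  injective (fun i => mu (f i)) -> simple_with_eigenrays C.
Proof.
move=> Cpt Cv v0 vext Uu GA mu0 Av muinj; set U := cols_mx _ in Uu.
have dA : diagonalizes U A (fun i => mu (f i)).
  by move=> i; rewrite col_cols_mx Av.
have vf m : exists i, ray (v (f i)) (v m).
  set c := invmx U *m v m.
  have mc i : (mu (f i) - mu m) * c i 0 = 0.
    have := coord_act Uu (v m) i dA; rewrite Av -scalemxAr mxE -/c => E.
    by rewrite mulrBl -E subrr.
  have [i ci] : exists i, c i 0 != 0.
    apply: contrapT => /forallNP c0; have /eqP := v0 m; apply.
    rewrite -[v m](mulKVmx Uu) -/c (_ : c = 0) ?mulmx0 //.
    by apply/matrixP=> i j; rewrite ord1 [RHS]mxE; apply/eqP/negPn/negP/c0.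
  have mui : mu (f i) = mu m.
    by have /eqP := mc i; rewrite mulf_eq0 (negPf ci) orbF subr_eq0 => /eqP.
  have Ev : v m = c i 0 *: v (f i).
    rewrite -[LHS](mulKVmx Uu) -/c mulmx_col_scale (bigD1 i) //= col_cols_mx.
    rewrite big1 ?addr0 // => j ji; have /eqP := mc j.
    rewrite mulf_eq0 -mui subr_eq0 (inj_eq muinj) (negPf ji) => /eqP->.
    by rewrite scale0r.
  exists i; exists (c i 0) => //.
  (* A negative coordinate would put both [v m] and its opposite in [C]. *)
  rewrite lt_neqAle eq_sym ci /= leNgt; apply/negP => cneg.
  have /eqP := v0 m; apply; apply: Cpt; first by rewrite Cv; apply: conic_gen.
  rewrite Ev -scaleNr Cv; apply: conicZ; last exact: conic_gen.
  by rewrite oppr_ge0 ltW.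
split.
  exists U => //; rewrite cone_of_cols_mx Cv.
  apply/seteqP; split; first exact: conic_ray_sub.
  by apply: conic_sub => i; apply: conic_gen.
exists (fun i => v (f i)); split.
  apply/seteqP; split=> [r|_ [i _ <-]]; last exact: vext.
  rewrite Cv => /extreme_ray_gen[m ->]; have [i /ray_eq E] := vf m.
  by exists i.
exists A, (fun i => mu (f i)); split=> // A1.
have mu1 i : mu i = 1.
  have := Av i; rewrite A1 act1 => /eqP; rewrite eq_sym -subr_eq0.
  rewrite -{2}[v i]scale1r -scalerBl scaler_eq0 (negPf (v0 i)) orbF.
  by rewrite subr_eq0 => /eqP.
by have := muinj ord0 ord_max; rewrite !mu1 => /(_ erefl).
Qed.

Lemma RG_finitely_generated_necessary (R : realType) (C : set 'cV[R]_3) :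
  polyhedral_cone C -> pointed C -> full_dimensional C ->
  RG_finitely_generated C ->
  all_rays_rational C \/ simple_with_eigenrays C.
Proof.
move=> Cpol Cpt Cfull [Rgen [G [[finR RC] [GG _] GC _ GR]]].
have [k [v [Cv v0 vext vinj]]] := minimal_generators Cpol Cpt.
have [f Uu] : exists f : 'I_3 -> 'I_k, cols_mx (fun i => v (f i)) \in unitmx.
  by apply: full_dimensional_basis; rewrite -Cv.
have [GGL _ GM GV] := GG.
have Gstab g : G g -> stabilizer C g.
  have gC h x : G h -> C x -> C (act h x).
    by move=> Gh Cx; rewrite -GC; exists h => //; exists x.
  move=> Gg; split=> [|x]; first exact: GGL.
  split=> [Cgx|]; last exact: gC.
  by rewrite -[x](actK _ (GGL _ Gg)); apply: gC => //; apply: GV.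
pose fixes g := forall i, ray (v i) (act g (v i)).
have [[g [mu [Gg mu0 gv muinj]]]|nodist] := pselect (exists g mu, [/\ G g,
    forall i, 0 < mu i, forall i, act g (v i) = mu i *: v i &
    injective (fun i => mu (f i))]).
  right; exact: (eigenbasis_simple_with_eigenrays Cpt Cv v0 vext Uu
    (GGL _ Gg) mu0 gv muinj).
left.
have Gfix1 g : G g -> fixes g -> g = 1%:M.
  move=> Gg gfix; have GLg := GGL _ Gg.
  have /choice[mu muP] : forall i, exists c, 0 < c /\ act g (v i) = c *: v i.
    by move=> i; have [c c0 E] := gfix i; exists c.
  pose a i := mu (f i).
  have a0 i : 0 < a i by case: (muP (f i)).
  have dg : diagonalizes (cols_mx (fun i => v (f i))) g a.
    by move=> i; rewrite col_cols_mx; case: (muP (f i)).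
  have /injectivePn[i [j ij aij]] : ~~ injectiveb a.
    apply/negP => /injectiveP ainj; apply: nodist; exists g, mu.
    by split=> // i; case: (muP i).
  have a1 := double_eigenvalue a0 (diagonalizes_cubic Uu GLg a0 dg) ij aij.
  have /diagonalizesP := dg; rewrite (_ : \row_i a i = const_mx 1); last first.
    by apply/rowP=> l; rewrite !mxE a1.
  rewrite diag_const_mx mulmx1 => /(congr1 (mulmx^~ (invmx _))).
  move/(_ (cols_mx (fun i => v (f i)))); rewrite mulmxK // mulmxV // => E.
  apply/matrixP=> r s; have /matrixP/(_ r s) := E; rewrite !mxE => /eqP.
  by rewrite -[X in _ == X](rmorph_nat intr) eqr_int => /eqP->; rewrite natz.
have sigma_ex g : G g -> exists s : {ffun 'I_k -> 'I_k},
    forall i, ray (v (s i)) (act g (v i)).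
  move=> Gg; have /choice[s sP] : forall i, exists j, ray (v j) (act g (v i)).
    move=> i; have := extreme_rays_act (Gstab _ Gg) (vext i).
    rewrite {1}Cv => /extreme_ray_gen[j E].
    by exists j; rewrite -E; apply: ray_refl.
  by exists (finfun s) => i; rewrite ffunE.
(* Elements inducing the same map [s] on the rays differ by one fixing all rays, hence are equal. *)
have finG : finite_set G.
  have /choice[pick pickP] : forall s : {ffun 'I_k -> 'I_k},
      exists g : 'M[int]_3, forall h, G h ->
        (forall i, ray (v (s i)) (act h (v i))) -> h = g.
    move=> s; have [[g [Gg gs]]|ng] := pselect (exists g, G g /\
        forall i, ray (v (s i)) (act g (v i))); last first.
      (* The value 0 is a default for maps that no element of [G] induces. *)
      by exists 0 => h Gh hs; case: ng; exists h.
    exists g => h Gh hs; have GLg := GGL _ Gg.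
    suff : invmx g *m h = 1%:M.
      by move/(congr1 (mulmx g)); rewrite mulKVmx // mulmx1.
    apply: Gfix1 => [|i]; first by apply: GM => //; apply: GV.
    have [c c0 E] : ray (act g (v i)) (act h (v i)) by rewrite -(ray_eq (gs i)).
    by exists c => //; rewrite actM E actZ actK.
  apply: (@sub_finite_set _ _ (range pick)).
    move=> g Gg; have [s sP] := sigma_ex g Gg.
    by exists s => //; rewrite (pickP s g).
  by apply: finite_image; apply: finite_finset.
(* As [G] is finite, the translates of [Rgen] are finitely many generators of the monoid. *)
have /finite_seqP[s Es] : finite_set [set act T x | T in G & x in Rgen].
  exact: finite_image2.
have sP x : [set act T x | T in G & x in Rgen] x ->
    exists i, x = tnth (in_tuple s) i.
  by rewrite Es => /(tnthP (in_tuple s) x).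
apply: (@finite_generation_rational _ _ _ C (tnth (in_tuple s))) => //.
  move=> i; have : [set act T x | T in G & x in Rgen] (tnth (in_tuple s) i).
    by rewrite Es; apply: mem_tnth.
  move=> [T GT [x /RC[Cx [z _ zx]] <-]]; have [_ TC] := Gstab _ GT.
  by split; [apply/TC|exists (T *m z) => //; rewrite -act_int zx].
move=> x /GR[m [lam [T [r [rR TG ->]]]]]; apply: conic_sum => i _.
rewrite -scaler_nat; apply: conicZ; first exact: ler0n.
have [|j ->] := sP (act (T i) (r i)); last exact: conic_gen.
by exists (T i) => //; exists (r i).
Qed.

Theorem theorem3p14 (R : realType) (C : set 'cV[R]_3)
    (C_polyhedral : polyhedral_cone C) (C_pointed : pointed C) :
  (full_dimensional C -> RG_finitely_generated C ->
     all_rays_rational C \/ simple_with_eigenrays C) /\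
  (all_rays_rational C \/ simple_with_eigenrays C ->
     RG_finitely_generated C).
Proof.
split=> [Cfull|]; first exact: RG_finitely_generated_necessary.
by case; [exact: rational_RG_finitely_generated
         |exact: eigenrays_RG_finitely_generated].
Qed.
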